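(* Let ${\rm Tr}(Q)=\|Q^{1/2}\|_{\rm HS}^2<\infty$ and $\|Y^0\|_{L_2(\Omega,\mathcal H_h^1)}<\infty$, and let $Y^n=[Y_1^n,Y_2^n]^T$ be given by the stochastic position Verlet scheme for the linear stochastic wave equation. Define the discrete energy and the modified energy by $$\mathcal E^n=\tfrac12\|\Lambda_h^{1/2}Y_1^n\|^2+\tfrac12\|Y_2^n\|^2,\qquad \mathcal E_m^n=\tfrac12\left\|(I-\tfrac{\tau^2}4\Lambda_h)^{-1/2}\Lambda_h^{1/2}Y_1^n\right\|^2+\tfrac12\|Y_2^n\|^2=\|Y^n\|_{m,1}^2 .$$ Then, under the CFL condition $\tau<C_{\rm CFL}h$ with $C_{\rm CFL}<2/\sqrt{C_s}$, the expected value of the modified energy satisfies $$\mathbb E[\mathcal E_m^n]=\mathbb E\left[\|Y^0\|_{m,1}^2\right]+t_n\sum_{k=0}^\infty\left\|DP_hQ^{1/2}e_k\right\|_{m,1}^2 .$$ Further, the expected value of the discrete energy is bounded, at $t_n=n\tau$, by $$\mathbb E[\mathcal E^n]\le C\left(\mathbb E\left[\|\Lambda_h^{1/2}Y_1^0\|^2+\|Y_2^0\|^2\right]+t_n\|Q^{1/2}\|_{\rm HS}^2\right),$$ where $C$ is a constant independent of $h$, $\tau$ and $n$.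
   Context: $\mathcal D\subset\mathbb R^d$, $d\in\{1,2,3\}$, is a bounded convex polytopal domain; $(\cdot,\cdot)$, $\|\cdot\|$ are the $L_2(\mathcal D)$ inner product and norm. $\mathbf D(x)$ is a symmetric $d\times d$ matrix function with $0<d_{\min}\le \zeta^T\mathbf D(x)\zeta\le d_{\max}<\infty$ for all $|\zeta|=1$. $W$ is a $Q$-Wiener process on a filtered probability space with normal filtration $\{\mathcal F_t\}$, $Q$ self-adjoint positive semidefinite on $L_2(\mathcal D)$; HS denotes Hilbert–Schmidt operators on $L_2(\mathcal D)$ and $\{e_k\}_{k\ge0}$ is an orthonormal basis of $L_2(\mathcal D)$. The linear stochastic wave equation is $d\dot u=\nabla\cdot(\mathbf D\nabla u)\,dt+dW$ with homogeneous Dirichlet boundary condition. **dG discretization.** $\mathcal T_h$ is a family of regular, quasi-uniform meshes of $\mathcal D$ (triangles/parallelograms for $d=2$, tetrahedra/parallelepipeds for $d=3$, intervals for $d=1$), $h$ the maximal element diameter. $V_h=\{u\in L_2(\mathcal D):u|_{K}\in\mathcal P^p(K)\ \forall K\in\mathcal T_h\}$, $\mathcal P^p$ the polynomials of total degree $\le p$, $p\ge1$. $\mathfrak F_h$ is the set of all faces, $h_{\mathfrak F}$ the diameter of face $\mathfrak F$. On an interior face shared by $K^\pm$ with outward normals $\mathbf n^\pm$: $\{u\}=\frac12(u^++u^-)$, $[u]=u^+\mathbf n^++u^-\mathbf n^-$; on a boundary face $\{u\}=u$, $[u]=u\mathbf n$. The symmetric interior penalty form is $$B_h(u,v)=\sum_K\int_K\mathbf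 D\nabla u\cdot\nabla v\,dx-\sum_{\mathfrak F}\int_{\mathfrak F}\{\mathbf D\nabla u\}\cdot[v]\,ds-\sum_{\mathfrak F}\int_{\mathfrak F}[u]\cdot\{\mathbf D\nabla v\}\,ds+\sigma_0\sum_{\mathfrak F}\int_{\mathfrak F}h_{\mathfrak F}^{-1}\mathbf D[u]\cdot[v]\,ds,$$ with $\sigma_0>0$ fixed, independent of $h$, large enough that $B_h(u,u)\ge\frac12\|u\|_*^2$ on $V_h$, where $\|u\|_*^2=\sum_K\|\nabla u\|_{L_2(K)}^2+\sum_Kh_K^2\|\Delta u\|_{L_2(K)}^2+\sum_{\mathfrak F}h_{\mathfrak F}^{-1}\|[u]\|_{L_2(\mathfrak F)}^2$. $C_s>0$ is an $h$-independent constant with $B_h(u,u)\le C_sh^{-2}\|u\|^2$ for $u\in V_h$. $\Lambda_h:V_h\to V_h$ is defined by $(\Lambda_hv,w)=B_h(v,w)$. $\mathcal H_h^1=V_h\times V_h$ with squared norm $\|\Lambda_h^{1/2}v_1\|^2+\|v_2\|^2$; $\|v\|_{L_2(\Omega,\mathcal H_h^1)}=\mathbb E[\|v\|_{\mathcal H_h^1}^2]^{1/2}$. $P_h$ is the $L_2$-projection onto $V_h$. **Scheme.** $\tau>0$, $t_n=n\tau$, $n=0,\dots,N$, $T=N\tau$, $\Delta W^n=W(t_n)-W(t_{n-1})$. $Y^0=U_{h,0}$ is an $\mathcal F_0$-measurable $V_h\times V_h$-valued random variable and $$Y^n=MY^{n-1}+DP_h\Delta W^n,\quad D=\begin{bmatrix}\frac\tau2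 I \\ I \end{bmatrix},\quad M=\begin{bmatrix}I-\frac{\tau^2}{2}\Lambda_h&\tau I-\frac{\tau^3}{4}\Lambda_h\\-\tau\Lambda_h&I-\frac{\tau^2}{2}\Lambda_h\end{bmatrix}.$$ **Discrete norm.** For $v=[v_1,v_2]^T\in V_h\times V_h$, under the CFL condition (which makes $I-\frac{\tau^2}4\Lambda_h$ positive definite), $\|v\|_{m,1}^2=\frac12\|(I-\frac{\tau^2}4\Lambda_h)^{-1/2}\Lambda_h^{1/2}v_1\|^2+\frac12\|v_2\|^2$. *)

(* Defs.v *)
From HB Require Import structures.
From mathcomp Require Import all_boot all_order all_algebra.
From mathcomp Require Import all_classical all_reals all_analysis.

Set Implicit Arguments.
Unset Strict Implicit.
Unset Printing Implicit Defensive.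

Import Order.TTheory GRing.Theory Num.Theory.
Import numFieldNormedType.Exports.

Local Open Scope classical_set_scope.
Local Open Scope ring_scope.

(* Points of R^n are row vectors.  The library norm of 'rV[R]_n is the max
   norm, so the Euclidean structure is introduced here. *)
Section euclidean.
Context {R : realType} {n : nat}.
Implicit Types x y : 'rV[R]_n.

Definition dot x y : R := \sum_i x 0 i * y 0 i.
Definition enorm x : R := Num.sqrt (dot x x).
Definition ediam (A : set 'rV[R]_n) : R :=
  sup [set enorm (z.1 - z.2) | z in A `*` A].

Definition grad (f : 'rV[R]_n -> R) x : 'rV[R]_n :=
  \row_i 'D_(delta_mx 0 i) f x.
Definition laplacian (f : 'rV[R]_n -> R) x : R :=
  \sum_i 'D_(delta_mx 0 i) (fun y => 'D_(delta_mx 0 i) f y) x.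
End euclidean.

(* The sigma-algebra generated by the coordinates, i.e. the Borel one. *)
Definition rv_display : measure_display. Proof. exact: default_measure_display. Qed.

Section rv_measurable.
Context {R : realType} (n : nat).

Definition rv_coord (i : 'I_n) (x : 'rV[R]_n) : R := x 0 i.

Let rv_set0 : g_sigma_preimage rv_coord set0.
Proof. exact: sigma_algebra0. Qed.

Let rv_setC A : g_sigma_preimage rv_coord A -> g_sigma_preimage rv_coord (~` A).
Proof. exact: sigma_algebraC. Qed.

Let rv_bigcup (F : _^nat) : (forall i, g_sigma_preimage rv_coord (F i)) ->
  g_sigma_preimage rv_coord (\bigcup_i (F i)).
Proof. exact: sigma_algebra_bigcup. Qed.

HB.instance Definition _ := @isMeasurable.Build rv_display
  'rV[R]_n (g_sigma_preimage rv_coord) rv_set0 rv_setC rv_bigcup.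
End rv_measurable.

Lemma measurable_rv_coord (R : realType) n (i : 'I_n) :
  measurable_fun [set: 'rV[R]_n] (fun x => x 0 i).
Proof.
move=> _ Y mY; rewrite setTI; apply: sub_sigma_algebra => /=.
rewrite -bigcup_seq/=; exists i => /=; first by rewrite mem_index_enum.
by exists Y => //; rewrite setTI.
Qed.

Lemma measurable_rvP (R : realType) n d (T : measurableType d)
    (f : T -> 'rV[R]_n) :
  (forall i, measurable_fun setT (fun t => f t 0 i)) -> measurable_fun setT f.
Proof.
move=> mf; suff : g_sigma_preimage (fun i => @rv_coord R n i \o f) `<=` measurable.
  move=> sub _ A mA; rewrite setTI; apply: sub.
  rewrite g_sigma_preimage_comp /=.
  by exists A => //; rewrite setTI.
apply: smallest_sub; first exact: sigma_algebra_measurable.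
rewrite -bigcup_seq => A [i _ [B mB <-]].
exact: mf.
Qed.

(* Lebesgue measure on R^n: the image of the iterated product measure under
   (t, x) |-> (t, x_0, ..., x_(n-1)); for n = 0 the unit mass. *)
Section lebesgue_step.
Context {R : realType} (n : nat).
Variable mu : {sigma_finite_measure set 'rV[R]_n -> \bar R}.

Definition rv_cons (z : measurableTypeR R * 'rV[R]_n) : 'rV[R]_n.+1 :=
  row_mx z.1%:M z.2 : 'rV[R]_(1 + n).

Lemma rv_cons0 z : rv_cons z 0 ord0 = z.1.
Proof.
rewrite /rv_cons (_ : ord0 = lshift n (ord0 : 'I_1)); last exact/val_inj.
by apply: (etrans (row_mxEl _ _ _ _)); rewrite mxE eqxx mulr1n.
Qed.

Lemma rv_consS z i : rv_cons z 0 (lift ord0 i) = z.2 0 i.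
Proof.
rewrite /rv_cons (_ : lift _ _ = rshift 1 i); last exact/val_inj.
exact: row_mxEr.
Qed.

Lemma measurable_rv_cons : measurable_fun setT rv_cons.
Proof.
apply: measurable_rvP => i; case: (unliftP ord0 i) => [j ->|->].
  under eq_fun do rewrite rv_consS.
  exact: measurableT_comp (measurable_rv_coord _) measurable_snd.
under eq_fun do rewrite rv_cons0.
exact: measurable_fst.
Qed.

Definition leb_step (A : set 'rV[R]_n.+1) : \bar R :=
  (@lebesgue_measure R \x mu)%E (rv_cons @^-1` A).

Let leb_step0 : leb_step set0 = 0%E.
Proof. by rewrite /leb_step preimage_set0 measure0. Qed.

Let leb_step_ge0 A : (0 <= leb_step A)%E.
Proof. exact: measure_ge0. Qed.

Let leb_step_sigma_additive : semi_sigma_additive leb_step.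
Proof.
exact: (@measure_semi_sigma_additive _ _ _
  (measure_function_pushforward__canonical__measure_function_Measure
    (@lebesgue_measure R \x mu)%E measurable_rv_cons)).
Qed.

HB.instance Definition _ := isMeasure.Build _ _ _ leb_step
  leb_step0 leb_step_ge0 leb_step_sigma_additive.

Let leb_step_sigma_finite : sigma_finite setT leb_step.
Proof.
have [F FT Foo] : sigma_finite setT (@lebesgue_measure R \x mu)%E.
  have /sigma_finiteP[F [TF ndF Foo]] := sigma_finiteT (@lebesgue_measure R).
  have /sigma_finiteP[G [TG ndG Goo]] := sigma_finiteT mu.
  exists (fun n => F n `*` G n).
    rewrite -setXTT TF TG predeqE => -[x y]; split.
      move=> [/= [k _ Fkx] [l _ Gly]]; exists (maxn k l) => //; split.
      - by move: x Fkx; exact/subsetPset/ndF/leq_maxl.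
      - by move: y Gly; exact/subsetPset/ndG/leq_maxr.
    by move=> [k _ []/= ? ?]; split; exists k.
  move=> k; have [? ?] := Foo k; have [? ?] := Goo k.
  split; first exact: measurableX.
  by rewrite product_measure1E// lte_mul_pinfty// ge0_fin_numE.
pose g (x : 'rV[R]_n.+1) : measurableTypeR R * 'rV[R]_n := (x 0 ord0, \row_i x 0 (lift ord0 i)).
have mg : measurable_fun setT g.
  apply/measurable_fun_pairP; split; first exact: measurable_rv_coord.
  apply: measurable_rvP => i; under eq_fun do rewrite /= mxE.
  exact: measurable_rv_coord.
have gK : cancel rv_cons g.
  move=> [a x]; rewrite /g rv_cons0; congr pair.
  by apply/rowP => i; rewrite mxE rv_consS.
exists (fun i => g @^-1` F i); first by rewrite -preimage_bigcup -FT preimage_setT.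
move=> i; have [mF Fi] := Foo i; split; first by rewrite -[X in measurable X]setTI; exact: mg.
rewrite /leb_step -comp_preimage (_ : g \o rv_cons = id)//.
by apply/funext => z; exact: gK.
Qed.

HB.instance Definition _ := Measure_isSigmaFinite.Build _ _ _ leb_step
  leb_step_sigma_finite.
End lebesgue_step.

Section lebesgue_rv.
Context {R : realType}.

Fixpoint leb n : {sigma_finite_measure set 'rV[R]_n -> \bar R} :=
  if n is n'.+1 then leb_step (leb n') else @dirac _ _ (0 : 'rV[R]_0) R.
End lebesgue_rv.

Section surface_integral.
Context {R : realType} {d : nat}.
Implicit Types (F : set 'rV[R]_d) (c : 'rV[R]_d * 'M[R]_(d.-1, d)).

(* An isometric parametrization t |-> y + t E of a hyperplane containing F. *)
Definition isometric_chart F c :=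
  c.2 *m c.2^T = 1%:M /\ F `<=` range (fun t : 'rV[R]_d.-1 => c.1 + t *m c.2).

(* The integral over a (d-1)-dimensional polytope F in R^d against the surface
   measure; its value does not depend on the chart.  For d = 1 it is the value
   at a point. *)
Definition surface_integral F (f : 'rV[R]_d -> R) : R :=
  let c := xget (0, 0) (isometric_chart F) in
  \int[leb d.-1]_(t in [set t | F (c.1 + t *m c.2)]) f (c.1 + t *m c.2).
End surface_integral.

Section domain.
Context {R : realType} {d : nat}.

(* The open polytope cut out by the half-spaces {x | c.1 . x < c.2}. *)
Definition polytope (G : seq ('rV[R]_d * R)) : set 'rV[R]_d :=
  [set x | forall c, c \in G -> dot c.1 x < c.2].

Definition polytopal_domain G := polytope G !=set0 /\ bounded_set (polytope G).

Lemma measurable_polytope G : measurable (polytope G).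
Proof.
elim: G => [|c G IH].
  by rewrite (_ : polytope _ = setT)//; apply/seteqP; split.
rewrite (_ : polytope _ = (dot c.1 @^-1` `]-oo, c.2[) `&` polytope G); last first.
  apply/seteqP; split => [x Gx|x [xc Gx] b].
    split; first by rewrite /= in_itv /=; apply: Gx; rewrite mem_head.
    by move=> b bG; apply: Gx; rewrite inE bG orbT.
  rewrite inE => /predU1P[->|/Gx//].
  by move: xc; rewrite /= in_itv.
apply: measurableI => //; rewrite -[X in measurable X]setTI.
suff : measurable_fun setT (dot c.1) by apply.
apply: measurable_sum => i; apply: measurable_realfun.measurable_funM.
  exact: measurable_cst.
exact: measurable_rv_coord.
Qed.

Definition domain_measure G : {measure set 'rV[R]_d -> \bar R} :=
  mrestr (leb d) (measurable_polytope G).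

(* Representatives of L_2(D): equality in L_2(D) is a.e. equality with respect
   to [domain_measure G], never Leibniz equality. *)
Definition L2 G := LfunType (domain_measure G) (lee1n 2).
HB.instance Definition _ G := GRing.Lmodule.on (L2 G).

Definition l2dot G (f g : 'rV[R]_d -> R) : R :=
  \int[domain_measure G]_x (f x * g x).
Definition l2norm G (f : 'rV[R]_d -> R) : R := Num.sqrt (l2dot G f f).

Definition diffusion_coefficient G (Dm : 'rV[R]_d -> 'M[R]_d) (dmin dmax : R) :=
  [/\ 0 < dmin,
      forall i j, measurable_fun (closure (polytope G)) (fun x => Dm x i j) &
      forall x, closure (polytope G) x -> (Dm x)^T = Dm x /\
        forall z, enorm z = 1 -> dmin <= dot (z *m Dm x) z <= dmax].
End domain.

Section operators.
Context {R : realType} {d : nat} (G : seq ('rV[R]_d * R)).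
Local Notation mu := (domain_measure G).
Implicit Types (S Q : L2 G -> L2 G) (e : nat -> L2 G).

(* Linearity and boundedness together make S compatible with a.e. equality. *)
Definition bounded_operator S :=
  (forall a (f g : L2 G),
     (S (a *: f + g) : 'rV[R]_d -> R) = (a *: S f + S g : L2 G) %[ae mu]) /\
  exists M, forall f : L2 G, l2norm G (S f) <= M * l2norm G f.

Definition psd_operator S := [/\ bounded_operator S,
  forall f g : L2 G, l2dot G (S f) g = l2dot G f (S g) &
  forall f : L2 G, 0 <= l2dot G (S f) f].

Definition sqrt_operator Q S :=
  psd_operator S /\ forall f : L2 G, (S (S f) : 'rV[R]_d -> R) = Q f %[ae mu].

Definition orthonormal_basis e :=
  (forall i j, l2dot G (e i) (e j) = (i == j)%:R) /\
  forall f : L2 G, (fun n => l2norm G (f - \sum_(k < n) l2dot G f (e k) *: e k : L2 G))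
    @ \oo --> (0 : R).

(* The square of the Hilbert-Schmidt norm. *)
Definition HS2 e S : \bar R := (\sum_(k <oo) (l2norm G (S (e k)) ^+ 2)%:E)%E.
End operators.

Definition measurable_wrt (R : realType) (Omega : Type) (H : set (set Omega))
    (X : Omega -> R) :=
  forall B : set R, measurable B -> H (X @^-1` B).

Section wiener.
Context {R : realType} {dd : measure_display} {Omega : measurableType dd}
  (P : probability Omega R).
Implicit Types (F : R -> set (set Omega)).

Definition normal_filtration F :=
  [/\ forall t, 0 <= t -> sigma_algebra setT (F t) /\ F t `<=` measurable,
      forall s t, 0 <= s -> s <= t -> F s `<=` F t,
      forall t, 0 <= t -> \bigcap_(s in [set s | t < s]) F s `<=` F t &
      forall A, measurable A -> P A = 0%E -> F 0 A].

(* [normal_prob] is not the Dirac mass when its standard deviation is 0. *)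
Definition centered_gaussian (v : R) (B : set R) : \bar R :=
  if v == 0 then \d_(0 : R) B else normal_prob 0 (Num.sqrt v) B.

Context {d : nat} (G : seq ('rV[R]_d * R)).

(* L_2(D) being separable, its Borel sigma-algebra is generated by the
   functionals f |-> (f, g). *)
Definition generated_by (X : Omega -> L2 G) : set (set Omega) :=
  <<s [set A | exists (g : L2 G) (B : set R),
        measurable B /\ A = (fun w => l2dot G (X w) g) @^-1` B] >>.

Definition wiener_process F (Q : L2 G -> L2 G) (W : R -> Omega -> L2 G) :=
  [/\ {ae P, forall w, l2norm G (W 0 w) = 0},
      {ae P, forall w, forall t, 0 <= t ->
        (fun s => l2norm G (W s w - W t w : L2 G)) @ within [set s | 0 <= s] (nbhs t)
          --> (0 : R)},
      forall t, 0 <= t -> generated_by (W t) `<=` F t,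
      forall s t, 0 <= s -> s <= t ->
        forall A B, F s A -> generated_by (fun w => W t w - W s w) B ->
          P (A `&` B) = (P A * P B)%E &
      forall s t, 0 <= s -> s <= t -> forall (g : L2 G) (B : set R), measurable B ->
        P ((fun w => l2dot G (W t w - W s w : L2 G) g) @^-1` B) =
        centered_gaussian ((t - s) * l2dot G (Q g) g) B].
End wiener.

(* A cell is the image of the reference simplex {s >= 0, sum s <= 1} or of the
   unit cube under s |-> cell_org + s cell_edges. *)
Record cell (R : realType) (d : nat) := Cell {
  cell_simplex : bool;
  cell_org : 'rV[R]_d;
  cell_edges : 'M[R]_d }.

Section cells.
Context {R : realType} {d : nat}.
Implicit Types (K : cell R d) (c : 'rV[R]_d * R) (J : seq ('rV[R]_d * R)).

(* The reference cell is {s | c.1 . s <= c.2 for c in ref_constraints}, one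
   constraint for each of its (d-1)-dimensional faces. *)
Definition ref_constraints K : seq ('rV[R]_d * R) :=
  [seq (- delta_mx 0 i, 0) | i <- enum 'I_d] ++
  (if cell_simplex K then [:: (const_mx 1, 1)]
   else [seq (delta_mx 0 i, 1) | i <- enum 'I_d]).

Definition cell_map K (s : 'rV[R]_d) := cell_org K + s *m cell_edges K.

(* The face of K where the constraints in J are active; K itself if J is empty. *)
Definition cell_face K J : set 'rV[R]_d := cell_map K @`
  [set s | (forall c, c \in ref_constraints K -> dot c.1 s <= c.2) /\
           forall c, c \in J -> dot c.1 s = c.2].
Definition cell_set K := cell_face K [::].
Definition cell_interior K := cell_map K @` polytope (ref_constraints K).

(* c.1 cell_edges^-T is the gradient of x |-> c.1 . s, where x = cell_map K s. *)
Definition outward_normal K c : 'rV[R]_d :=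
  let g := c.1 *m (invmx (cell_edges K))^T in (enorm g)^-1 *: g.
End cells.

Record mesh (R : realType) (d : nat) := Mesh {
  ncells : nat;
  cells :> 'I_ncells -> cell R d }.

Section meshes.
Context {R : realType} {d : nat}.
Implicit Types (T : mesh R d) (F : set 'rV[R]_d).

Definition mesh_size T : R := \big[Num.max/0]_(i < ncells T) ediam (cell_set (T i)).

(* The last clause is conformity: distinct cells meet in a common proper face,
   possibly empty. *)
Definition mesh_of (G : seq ('rV[R]_d * R)) T :=
  [/\ forall i, cell_edges (T i) \in unitmx,
      \bigcup_i cell_set (T i) = closure (polytope G) &
      forall i j, i != j -> exists Ji Jj,
        [/\ Ji != [::] /\ {subset Ji <= ref_constraints (T i)},
            Jj != [::] /\ {subset Jj <= ref_constraints (T j)},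
            cell_set (T i) `&` cell_set (T j) = cell_face (T i) Ji &
            cell_set (T i) `&` cell_set (T j) = cell_face (T j) Jj]].

Definition regular_quasi_uniform (G : seq ('rV[R]_d * R)) (TT : set (mesh R d)) :=
  (forall T, TT T -> mesh_of G T) /\
  exists rho kappa : R, forall T, TT T -> forall i,
    (exists (x : 'rV[R]_d) (r : R),
       [/\ 0 < r, [set y | enorm (y - x) <= r] `<=` cell_set (T i) &
           ediam (cell_set (T i)) <= rho * r]) /\
    mesh_size T <= kappa * ediam (cell_set (T i)).

Definition mesh_faces T : set (set 'rV[R]_d) :=
  [set F | exists i, exists2 c, c \in ref_constraints (T i) &
    F = cell_face (T i) [:: c]].

(* The cells K+, K- sharing F (a single one if F is a boundary face), each with
   the constraint defining F in it. *)
Definition incident T F : seq ('I_(ncells T) * ('rV[R]_d * R)) :=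
  [seq k <- [seq (i, c) | i <- enum 'I_(ncells T), c <- ref_constraints (T i)]
     | `[< cell_face (T k.1) [:: k.2] = F >]].

(* For d = 1 faces are points and their diameter is replaced by the length of
   the largest adjacent interval. *)
Definition face_size T F : R :=
  if d == 1%N then \big[Num.max/0]_(k <- incident T F) ediam (cell_set (T k.1))
  else ediam F.
End meshes.

(* Multi-indices of total degree at most p. *)
Definition multi_index (d p : nat) :=
  {a : {ffun 'I_d -> 'I_p.+1} | (\sum_i a i <= p)%N}.

(* Polynomials of total degree at most p, given by their coefficients. *)
Definition poly_space (R : realType) d p : vectType R :=
  {ffun multi_index d p -> R^o}.

Definition poly_eval (R : realType) d p (u : poly_space R d p) (x : 'rV[R]_d) : R :=
  \sum_(a : multi_index d p) (u : {ffun _ -> R^o}) a * \prod_i x 0 i ^+ (val a i).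

(* The discontinuous finite element space V_h, one polynomial per cell. *)
Definition dgspace (R : realType) d p (T : mesh R d) : vectType R :=
  {ffun 'I_(ncells T) -> poly_space R d p}.

Definition dg_restr (R : realType) d p (T : mesh R d) (u : dgspace p T)
    (i : 'I_(ncells T)) : poly_space R d p :=
  (u : {ffun _ -> poly_space R d p}) i.

Section dg.
Context {R : realType} {d p : nat} (G : seq ('rV[R]_d * R)).
Variable T : mesh R d.
Local Notation V := (dgspace p T).
Implicit Types (u v : V) (F : set 'rV[R]_d) (x : 'rV[R]_d).

(* The element of L_2(D) represented by u; it is set to 0 on the skeleton. *)
Definition dgfun u x : R :=
  \sum_i \1_(cell_interior (T i)) x * poly_eval (dg_restr u i) x.

Definition dgdot u v : R := l2dot G (dgfun u) (dgfun v).
Definition dgnorm u : R := l2norm G (dgfun u).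

Definition average F (q : 'I_(ncells T) -> 'rV[R]_d) : 'rV[R]_d :=
  (size (incident T F))%:R^-1 *: \sum_(k <- incident T F) q k.1.
Definition jump F u x : 'rV[R]_d :=
  \sum_(k <- incident T F) poly_eval (dg_restr u k.1) x *: outward_normal (T k.1) k.2.

Variables (Dm : 'rV[R]_d -> 'M[R]_d) (sigma0 : R).

(* The flux D grad u, as a row vector. *)
Definition flux u i x : 'rV[R]_d := grad (poly_eval (dg_restr u i)) x *m (Dm x)^T.

Definition sip_form u v : R :=
  \sum_i \int[leb d]_(x in cell_set (T i)) dot (flux u i x) (grad (poly_eval (dg_restr v i)) x)
  - \sum_(F \in mesh_faces T)
      surface_integral F (fun x => dot (average F (fun i => flux u i x)) (jump F v x))
  - \sum_(F \in mesh_faces T)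
      surface_integral F (fun x => dot (jump F u x) (average F (fun i => flux v i x)))
  + sigma0 * \sum_(F \in mesh_faces T)
      surface_integral F (fun x =>
        (face_size T F)^-1 * dot (jump F u x *m (Dm x)^T) (jump F v x)).

(* The square of the norm |u|_*. *)
Definition star_norm2 u : R :=
  \sum_i \int[leb d]_(x in cell_set (T i)) (enorm (grad (poly_eval (dg_restr u i)) x) ^+ 2)
  + \sum_i ediam (cell_set (T i)) ^+ 2 *
      \int[leb d]_(x in cell_set (T i)) (laplacian (poly_eval (dg_restr u i)) x ^+ 2)
  + \sum_(F \in mesh_faces T) (face_size T F)^-1 *
      surface_integral F (fun x => enorm (jump F u x) ^+ 2).

Definition discrete_operator (Lam : 'End(V)) :=
  forall v w, dgdot (Lam v) w = sip_form v w.

Definition l2_projection (Ph : L2 G -> V) :=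
  forall f w, dgdot (Ph f) w = l2dot G f (dgfun w).

(* S is the positive semidefinite square root of A. *)
Definition dg_sqrt (A S : 'End(V)) :=
  [/\ forall u v, dgdot (S u) v = dgdot u (S v), forall u, 0 <= dgdot (S u) u &
      (S \o S)%VF = A].
End dg.

Section verlet.
Context {R : realType} {d p : nat} (G : seq ('rV[R]_d * R)) {T : mesh R d}.
Local Notation V := (dgspace p T).
Implicit Types (v : V * V) (tau : R).

Definition verlet_M tau (Lam : 'End(V)) v : V * V :=
  ((v.1 - (tau ^+ 2 / 2) *: Lam v.1) + (tau *: v.2 - (tau ^+ 3 / 4) *: Lam v.2),
   - (tau *: Lam v.1) + (v.2 - (tau ^+ 2 / 2) *: Lam v.2)).

Definition verlet_D tau (f : V) : V * V := ((tau / 2) *: f, f).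

Fixpoint position_verlet tau (Lam : 'End(V)) (Ph : L2 G -> V) (Omega : Type)
    (W : R -> Omega -> L2 G) (Y0 : Omega -> V * V) (n : nat) (w : Omega) : V * V :=
  if n is m.+1 then
    verlet_M tau Lam (position_verlet tau Lam Ph W Y0 m w) +
    verlet_D tau (Ph (W (m.+1%:R * tau) w - W (m%:R * tau) w))
  else Y0 w.

(* In the next definitions S stands for Lambda_h^(1/2) and
   M for (I - tau^2/4 Lambda_h)^(-1/2). *)
Definition H1_norm2 (S : 'End(V)) v : R := dgnorm G (S v.1) ^+ 2 + dgnorm G v.2 ^+ 2.

Definition energy (S : 'End(V)) v : R :=
  2^-1 * dgnorm G (S v.1) ^+ 2 + 2^-1 * dgnorm G v.2 ^+ 2.

Definition modified_norm2 (M S : 'End(V)) v : R :=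
  2^-1 * dgnorm G (M (S v.1)) ^+ 2 + 2^-1 * dgnorm G v.2 ^+ 2.

Definition dg_random_variable (Omega : Type) (H : set (set Omega))
    (Y : Omega -> V * V) :=
  forall i a, measurable_wrt H (fun w => (dg_restr (Y w).1 i : {ffun _ -> R^o}) a) /\
              measurable_wrt H (fun w => (dg_restr (Y w).2 i : {ffun _ -> R^o}) a).
End verlet.

(* Main.v *)
Require Import Defs.
From HB Require Import structures.
From mathcomp Require Import all_boot all_order all_algebra.
From mathcomp Require Import all_classical all_reals all_analysis.
From mathcomp Require Import measurable_realfun ring lra.

Set Implicit Arguments.
Unset Strict Implicit.
Unset Printing Implicit Defensive.
Import Order.TTheory GRing.Theory Num.Theory.
Import numFieldNormedType.Exports.
Local Open Scope classical_set_scope.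
Local Open Scope ring_scope.

(* The Verlet matrix is an isometry for the modified energy: with
   A = I - tau^2/4 Lambda, every block of M is a polynomial in Lambda and the
   identity reduces to (2A - I)^2 + tau^2 Lambda A = I.  Hence one step only adds
   the noise.  The modified energy is a finite sum of squares of linear
   functionals; on each of them the increment of W contributes an independent
   centered Gaussian (phi, Delta W) of variance tau (Q phi, phi), so its second
   moment grows by exactly this variance, and Parseval's identity for Q^(1/2)
   turns the sum of the variances into the Hilbert-Schmidt sum.  The bound on the
   discrete energy follows from I <= A^-1 <= (1 - Cs Ccfl^2 / 4)^-1 I.

   All the linear algebra is done for a positive semidefinite form, modulo vectors
   of seminorm 0, so that the definiteness of the inner product on V_h is never
   needed. *)

(** * Semi-inner products and the Verlet step *)

Definition psd_form (R : numDomainType) (V : lmodType R) (b : V -> V -> R) :=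
  [/\ forall a u v w, b (a *: u + v) w = a * b u w + b v w,
      forall u v, b u v = b v u & forall u, 0 <= b u u].

Section psd_form_theory.
Context {R : realFieldType} {V : lmodType R} (b : V -> V -> R).
Hypothesis psd_b : psd_form b.

Let b_linear : forall a u v w, b (a *: u + v) w = a * b u w + b v w.
Proof. by case: psd_b. Qed.

Lemma formC u v : b u v = b v u.
Proof. by case: psd_b. Qed.

Lemma form_ge0 u : 0 <= b u u.
Proof. by case: psd_b. Qed.

Lemma formDl u v w : b (u + v) w = b u w + b v w.
Proof. by rewrite -[u]scale1r b_linear mul1r scale1r. Qed.

Lemma form0l w : b 0 w = 0.
Proof. by apply: (addrI (b 0 w)); rewrite -formDl !addr0. Qed.

Lemma formZl a u w : b (a *: u) w = a * b u w.
Proof. by rewrite -[a *: u]addr0 b_linear form0l addr0. Qed.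

Lemma formNl u w : b (- u) w = - b u w.
Proof. by rewrite -scaleN1r formZl mulN1r. Qed.

Lemma formDr u v w : b w (u + v) = b w u + b w v.
Proof. by rewrite formC formDl !(formC w). Qed.

Lemma formZr a u w : b w (a *: u) = a * b w u.
Proof. by rewrite formC formZl (formC w). Qed.

Lemma formNr u w : b w (- u) = - b w u.
Proof. by rewrite formC formNl (formC w). Qed.

Definition formE := (formDl, formDr, formNl, formNr, formZl, formZr).

Lemma form_suml (I : Type) (r : seq I) (F : I -> V) w :
  b (\sum_(i <- r) F i) w = \sum_(i <- r) b (F i) w.
Proof.
elim: r => [|i r IH]; first by rewrite !big_nil form0l.
by rewrite !big_cons formDl IH.
Qed.

(** If [b u u = 0], the nonnegative quantity [b (a *: u + w) (a *: u + w)] is affine in [a], so its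
    slope [2 * b u w] must vanish. *)
Lemma form_null u w : b u u = 0 -> b u w = 0.
Proof.
move=> u0; have H a : 0 <= a * b u w *+ 2 + b w w.
  have := form_ge0 (a *: u + w); rewrite !formE u0 (formC w u); lra.
(* At this [a] the affine function would take the value -1. *)
have := H (- (b w w + 1) / 2 / b u w).
by case: (eqVneq (b u w) 0) => // n0; rewrite divfK//; lra.
Qed.

Lemma form_CauchySchwarz u w : b u w ^+ 2 <= b u u * b w w.
Proof.
have [u0|u0] := eqVneq (b u u) 0; first by rewrite form_null// u0 mul0r expr0n.
have up : 0 < b u u by rewrite lt_def u0 form_ge0.
have := form_ge0 (b u u *: w - b u w *: u).
have -> : b (b u u *: w - b u w *: u) (b u u *: w - b u w *: u) =
    b u u * (b u u * b w w - b u w ^+ 2).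
  by rewrite !formE (formC w u); ring.
by rewrite pmulr_rge0// subr_ge0.
Qed.
End psd_form_theory.

(** One Gram-Schmidt step: this is [b] evaluated on the components orthogonal to [x]. *)
Lemma psd_form_deflate (R : realFieldType) (V : lmodType R) (b : V -> V -> R) x :
  psd_form b -> b x x != 0 ->
  psd_form (fun u w => b u w - b u x * b w x / b x x).
Proof.
move=> pb x0; split => [a u v w|u v|u]; first by rewrite !(formE pb); field.
  by rewrite (formC pb u v); field.
have -> : b u u - b u x * b u x / b x x = b (u - (b u x / b x x) *: x) (u - (b u x / b x x) *: x).
  by rewrite !(formE pb) (formC pb x u); field.
exact: form_ge0.
Qed.

(** Symmetric Gaussian elimination for a possibly degenerate form: each pivot of nonzero seminorm
    gives one square and is then deflated, and pivots of seminorm 0 are skipped. *)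
Lemma psd_form_sum_squares (R : rcfType) (V : vectType R) (b : V -> V -> R) :
  psd_form b -> exists s : seq V, forall u, b u u = \sum_(v <- s) b u v ^+ 2.
Proof.
(* For the induction, [X] need not span: it only has to detect the vectors of seminorm 0. A basis
   does, and the property survives deflation. *)
suff main (X : seq V) : psd_form b ->
    (forall u, (forall v, v \in X -> b u v = 0) -> b u u = 0) ->
    exists s : seq V, forall u, b u u = \sum_(v <- s) b u v ^+ 2.
  move=> pb; apply: (main (vbasis {:V})) => // u u0.
  rewrite {2}(coord_vbasis (memvf u)) (formC pb) (form_suml pb) big1// => i _.
  by rewrite (formZl pb) (formC pb) u0 ?mulr0// mem_nth// size_tuple.
elim: X b => [b _ b0|x X IH b pb b0].
  by exists [::] => u; rewrite big_nil b0.
case: (eqVneq (b x x) 0) => [x0|x0].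
  apply: (IH b pb) => u uX; apply: b0 => v; rewrite inE => /predU1P[->|/uX//].
  by rewrite (formC pb) (form_null pb).
have [|s sP] := IH _ (psd_form_deflate pb x0).
  (* [u'] is the part of [u] orthogonal to [x], and [b u' w] is the deflated form at [u] and [w]. *)
  move=> u uX; pose u' := u - (b u x / b x x) *: x.
  have u'E w : b u' w = b u w - b u x * b w x / b x x.
    by rewrite !(formE pb) (formC pb x w); field.
  have u'x : b u' x = 0 by rewrite u'E; field.
  rewrite -u'E; suff <- : b u' u' = b u' u.
    by apply: b0 => v; rewrite inE => /predU1P[->//|vX]; rewrite u'E uX.
  by rewrite u'E u'x mulr0 mul0r subr0 (formC pb).
(* The normalised [x] restores the square removed by deflation; once its component along [x] is
   subtracted, [v] pairs with [u] under [b] as it did under the deflated form. *)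
exists ((Num.sqrt (b x x))^-1 *: x :: [seq v - (b v x / b x x) *: x | v <- s]) => u.
rewrite big_cons big_map.
under eq_bigr => v _.
  have -> : b u (v - (b v x / b x x) *: x) = b u v - b u x * b v x / b x x.
    by rewrite !(formE pb); field.
  over.
rewrite -sP (formZr pb) exprMn exprVn sqr_sqrtr ?(form_ge0 pb)//; field => //.
Qed.

Section end_linear.
Context {R : fieldType} {V : vectType R} (f : 'End(V)).

Lemma endD u v : f (u + v) = f u + f v. Proof. exact: linearD. Qed.
Lemma endN u : f (- u) = - f u. Proof. exact: linearN. Qed.
Lemma endZ a u : f (a *: u) = a *: f u. Proof. exact: linearZ. Qed.
Definition endE := (endD, endN, endZ).
End end_linear.

(** * Invariance of the modified energy and its comparison with the discrete energy *)

Section verlet_energy.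
Context {R : realFieldType} {V : vectType R} (b : V -> V -> R) (psd_b : psd_form b).
Variables (S M Lam : 'End(V)) (tau theta : R).
Let A : 'End(V) := (\1 - (tau ^+ 2 / 4) *: Lam)%VF.
Hypothesis S_sym : forall u v, b (S u) v = b u (S v).
Hypothesis SS : (S \o S)%VF = Lam.
Hypothesis M_sym : forall u v, b (M u) v = b u (M v).
Hypothesis MM : (M \o M)%VF = (A^-1)%VF.
Hypothesis theta_lt1 : theta < 1.
Hypothesis cfl : forall u, tau ^+ 2 / 4 * b (Lam u) u <= theta * b u u.

Let AE u : A u = u - (tau ^+ 2 / 4) *: Lam u.
Proof. by rewrite /A !lfunE /= !lfunE /= !lfunE. Qed.

Let LamE u : Lam u = S (S u).
Proof. by rewrite -SS comp_lfunE. Qed.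

Let Lam_sym u v : b (Lam u) v = b u (Lam v).
Proof. by rewrite !LamE !S_sym. Qed.

Let A_sym u v : b (A u) v = b u (A v).
Proof. by rewrite !AE !(formE psd_b) Lam_sym. Qed.

Let AS u : A (S u) = S (A u).
Proof. by rewrite !AE !endE !LamE. Qed.

Let A_ge u : (1 - theta) * b u u <= b (A u) u.
Proof. rewrite AE !(formE psd_b); have := cfl u; lra. Qed.

(** Coercivity of [A] with [theta < 1] leaves only vectors of seminorm 0 in the kernel of [A]. *)
Let A_null u w : A u = 0 -> b u w = 0.
Proof.
move=> Au; apply: (form_null psd_b).
have := A_ge u; rewrite Au (form0l psd_b); have := form_ge0 psd_b u.
move: (b u u) => x x0 x1; apply/eqP; rewrite eq_le x0 andbT.
by move: x1; rewrite pmulr_rle0 ?subr_gt0.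
Qed.

Local Notation B u := (M (M u)).

(** [A^-1] is a generalized inverse, hence a right inverse of [A] on the image of [A], where [A u]
    lies. *)
Let AB u : A (B (A u)) = A u.
Proof.
have -> : B (A u) = (A^-1)%VF (A u) by rewrite -MM comp_lfunE.
have : A u \in limg A by rewrite memv_img// memvf.
by move/limg_lfunVK.
Qed.

Let B_sym u v : b (B u) v = b u (B v).
Proof. by rewrite !M_sym. Qed.

(* The operators are only inverse to each other modulo the vectors of
   seminorm 0. *)
Let BA u w : b (B (A u)) w = b u w.
Proof.
apply/eqP; rewrite -subr_eq0 -(formNl psd_b) -(formDl psd_b); apply/eqP.
by apply: A_null; rewrite !endE AB subrr.
Qed.

Let BA' u w : b (B u) (A w) = b u w.
Proof. by rewrite B_sym (formC psd_b) BA (formC psd_b). Qed.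

Definition verlet_form (u v : V * V) :=
  2^-1 * b (M (S u.1)) (M (S v.1)) + 2^-1 * b u.2 v.2.

Lemma verlet_formE u : verlet_form u u = 2^-1 * b (B (S u.1)) (S u.1) + 2^-1 * b u.2 u.2.
Proof. by rewrite /verlet_form -(M_sym _ (S _)). Qed.

Lemma verlet_form_invariant (u : V * V) (x y : V) :
  x = (u.1 - (tau ^+ 2 / 2) *: Lam u.1) + (tau *: u.2 - (tau ^+ 3 / 4) *: Lam u.2) ->
  y = - (tau *: Lam u.1) + (u.2 - (tau ^+ 2 / 2) *: Lam u.2) ->
  verlet_form (x, y) (x, y) = verlet_form u u.
Proof.
move=> xE yE; rewrite !verlet_formE /=.
have SL w : S (Lam w) = Lam (S w) by rewrite !LamE.
(* [S] commutes with [Lam], and the block [tau - tau^3/4 Lam] of the Verlet matrix is [tau *: A]. *)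
have {xE} -> : S x = (S u.1 - (tau ^+ 2 / 2) *: Lam (S u.1)) + tau *: A (S u.2).
  rewrite xE AE !endE /= !SL scalerBr scalerA.
  by congr (_ + (_ - _ *: _)); field.
have {yE} -> : y = - (tau *: S (S u.1)) + (u.2 - (tau ^+ 2 / 2) *: S (S u.2)).
  by rewrite yE !LamE.
set s := S u.1; set t := S u.2; set y0 := u.2.
(* In the form [(2A - I) s], every [A] cancels against [B]; the one remaining term with [B] is
   [b (B s) s], which also stands on the other side. *)
have -> : s - (tau ^+ 2 / 2) *: Lam s = 2 *: A s - s.
  by rewrite AE scalerBr scalerA scaler_nat mulr2n addrAC addrK; congr (_ - _ *: _); field.
have Et : S y0 = t by [].
(* The rest is an identity for arbitrary [s], with [t] tied to [y0] only by [S y0 = t]. *)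
clearbody s t.
rewrite !endE /=.
rewrite !(formE psd_b) !BA !BA' (formC psd_b s (A s)) (formC psd_b (B s) s).
have SS' v w : b (S v) (S w) = b v (Lam w) by rewrite S_sym -LamE.
have Sy v : b (S v) y0 = b v t by rewrite S_sym Et.
have yS v : b y0 (S v) = b v t by rewrite (formC psd_b) Sy.
rewrite !SS' !Sy !yS !AE !(formE psd_b) -(Lam_sym t s).
rewrite (formC psd_b (Lam t) s) (formC psd_b (Lam s) s) (formC psd_b t s).
by field.
Qed.

(** This is [I <= A^-1] at [s = S u.1]: the difference [b (B s) s - b s s] equals [tau^2/4] times
    the squared seminorm of [M (S s)]. *)
Lemma energy_le_verlet_form u :
  2^-1 * b (S u.1) (S u.1) + 2^-1 * b u.2 u.2 <= verlet_form u u.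
Proof.
rewrite verlet_formE lerD2r ler_pM2l ?invr_gt0//; set s := S u.1.
(* [B] and [S] commute only modulo vectors of seminorm 0, by inserting [B A] and using that [A] and
   [S] commute. *)
have BS v w : b (B (S v)) w = b (S (B v)) w.
  rewrite -[RHS]BA AS [RHS]B_sym [RHS]S_sym [RHS]A_sym [RHS]B_sym.
  by rewrite [RHS](formC psd_b) BA [RHS]S_sym [RHS]B_sym (formC psd_b).
rewrite -subr_ge0 -(BA' s s) -(formNr psd_b) -(formDr psd_b) AE opprB addrCA subrr addr0.
by rewrite (formZr psd_b) LamE -S_sym -BS M_sym mulr_ge0 ?(form_ge0 psd_b)// divr_ge0 ?sqr_ge0.
Qed.

Lemma verlet_form_le (kappa := (1 - theta)^-1) u :
  verlet_form u u <= 2^-1 * (kappa * b (S u.1) (S u.1)) + 2^-1 * b u.2 u.2.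
Proof.
rewrite verlet_formE lerD2r ler_pM2l ?invr_gt0//; set s := S u.1.
have th0 : 0 < 1 - theta by rewrite subr_gt0.
rewrite /kappa ler_pdivlMl//.
(* With [x = b (B s) s], [y = b (B s) (B s)] and [z = b s s], coercivity gives [(1 - theta) y <= x]
   and Cauchy-Schwarz [x^2 <= y z]; dividing by [x] yields [(1 - theta) x <= z]. *)
have h1 := A_ge (B s); rewrite A_sym BA' in h1.
have h2 := form_CauchySchwarz psd_b (B s) s.
have x0 : 0 <= b (B s) s by rewrite M_sym form_ge0.
move: h1 h2 x0; rewrite (formC psd_b s).
have := form_ge0 psd_b s.
move: (b (B s) s) (b (B s) (B s)) (b s s) => x y z z0 h1 h2.
rewrite le_eqVlt => /predU1P[<-|x0]; first by rewrite mulr0.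
rewrite -(ler_pM2l x0) mulrCA -expr2 (le_trans (ler_wpM2l (ltW th0) h2))//.
by rewrite mulrA ler_wpM2r.
Qed.

End verlet_energy.

(** The blocks are polynomials in the self-adjoint [Lam], so transposing the Verlet matrix only
    swaps its off-diagonal blocks. *)
Lemma verlet_adjoint (R : realFieldType) (V : vectType R) (b : V -> V -> R)
    (Lam : 'End(V)) (a c t : R) (x y u v : V) :
  psd_form b -> (forall u v, b (Lam u) v = b u (Lam v)) ->
  b ((x - a *: Lam x) + (t *: y - c *: Lam y)) u +
    b (- (t *: Lam x) + (y - a *: Lam y)) v =
  b x (u - a *: Lam u - t *: Lam v) +
    b y (t *: u - c *: Lam u + (v - a *: Lam v)).
Proof. by move=> pb sym; rewrite !(formE pb) !sym; ring. Qed.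

(** * Second moments of Gaussian increments *)

Section normal_moments.
Context {R : realType}.
Local Notation mu := (@lebesgue_measure R).

(** The Radon-Nikodym derivative and [normal_pdf] have the same integral over every measurable set,
    so they agree almost everywhere. *)
Lemma ge0_integral_normal_prob (s : R) (f : measurableTypeR R -> \bar R) :
  measurable_fun setT f -> (forall x, (0 <= f x)%E) ->
  (\int[normal_prob 0 s]_x f x = \int[mu]_x (f x * (normal_pdf 0 s x)%:E))%E.
Proof.
move=> mf f0; have dom : normal_prob 0 s `<< mu by exact: normal_prob_dominates.
rewrite -(Radon_Nikodym_SigmaFinite.change_of_variables dom f0)//.
have iRN := Radon_Nikodym_SigmaFinite.f_integrable dom.
have mpdf : measurable_fun setT (EFin \o normal_pdf 0 s).
  by apply/measurable_EFinP; exact: measurable_normal_pdf.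
apply: ae_eq_integral => //.
- by apply: emeasurable_funM => //; exact: measurable_int iRN.
- exact: emeasurable_funM.
apply: ae_eqe_mul2l; apply: integral_ae_eq => // A _ mA.
by rewrite -Radon_Nikodym_SigmaFinite.f_integral.
Qed.

Context (s c : R) (s0 : s != 0).
Local Notation phi := (normal_pdf 0 s).
(* [F' = f] and [(x + c)^2 phi = f + (s^2 + c^2) phi]. *)
Let F x := - s ^+ 2 * (x + 2 * c) * phi x.
Let f x := ((x + c) ^+ 2 - (s ^+ 2 + c ^+ 2)) * phi x.

Let is_derive_F x : is_derive x (1 : R) F (f x).
Proof.
have dphi : is_derive x (1 : R) phi (- x / s ^+ 2 * phi x).
  rewrite normal_pdfE// /normal_fun.
  apply: is_derive_eq.
  rewrite /GRing.scale /= /normal_fun; field.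
  by rewrite s0.
apply: is_derive_eq; rewrite /f /GRing.scale /=; field.
by rewrite s0.
Qed.

Let cf : continuous f.
Proof.
move=> x; apply: cvgM; last exact: continuous_normal_pdf.
apply: cvgB; last exact: cvg_cst.
by apply: (@continuous_comp _ _ _ (fun y => y + c) (fun y => y ^+ 2));
  [apply: cvgD; [exact: cvg_id|exact: cvg_cst]|exact: exprn_continuous].
Qed.

Let phiN x : phi (- x) = phi x.
Proof. by rewrite normal_pdfE// /normal_fun !subr0 sqrrN. Qed.

(** From [e^y >= 1 + y] at [y = x^2/q] with [q = 2 s^2]. *)
Let xphi_le x : 0 < x -> x * phi x <= normal_peak s * (s ^+ 2 *+ 2) * x^-1.
Proof.
move=> x0; rewrite normal_pdfE// /normal_fun subr0 mulNr expRN.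
set q := s ^+ 2 *+ 2; have q0 : 0 < q by rewrite pmulrn_lgt0// exprn_even_gt0.
rewrite mulrCA -mulrA ler_wpM2l ?normal_peak_ge0//.
rewrite ler_pdivrMr ?expR_gt0// -ler_pdivrMl; last first.
  by rewrite divr_gt0.
rewrite invf_div mulrAC -expr2 (le_trans _ (expR_ge1Dx _))// lerDr//.
Qed.

(** [phi] is even, so the terms with [c] cancel and a multiple of [x phi(x)] is left, which is
    bounded by a multiple of [1/x]. *)
Let F_cvg0 : (F n.+1%:R - F (- n.+1%:R)) @[n --> \oo] --> (0 : R).
Proof.
have FE x : F x - F (- x) = - (2 * s ^+ 2) * (x * phi x).
  by rewrite /F phiN; ring.
under eq_fun do rewrite FE.
suff xphi0 : n.+1%:R * phi n.+1%:R @[n --> \oo] --> (0 : R).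
  by have := cvgM (cvg_cst (- (2 * s ^+ 2))) xphi0; rewrite mulr0; apply.
set K := normal_peak s * (s ^+ 2 *+ 2).
have : K * harmonic n @[n --> \oo] --> (0 : R).
  by have := cvgM (cvg_cst K) (@cvg_harmonic R); rewrite mulr0; apply.
apply: squeeze_cvgr; last exact: cvg_cst.
apply: nearW => n /=; rewrite mulr_ge0 ?normal_pdf_ge0//=.
exact: xphi_le.
Qed.

(** With [n.+1] every interval is nondegenerate, as the fundamental theorem of calculus requires. *)
Let I (n : nat) : set R := `[- n.+1%:R, n.+1%:R].

Let nd_I : nondecreasing_seq I.
Proof.
move=> m n mn; rewrite subsetEset => x; rewrite /I /= !in_itv /= => /andP[h1 h2].
have mn' : m.+1%:R <= n.+1%:R :> R by rewrite ler_nat.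
by rewrite (le_trans _ h1) ?lerN2// (le_trans h2).
Qed.

Let bigcup_I : \bigcup_n I n = setT.
Proof.
apply/seteqP; split => // x _; exists (Num.truncn `|x|) => //.
rewrite /I /= in_itv /= -ler_norml; exact/ltW/truncnS_gt.
Qed.

Let cphi : continuous phi.
Proof. exact: continuous_normal_pdf. Qed.

Let integral_I n :
  (\int[mu]_(x in I n) (((x + c) ^+ 2)%:E * (phi x)%:E) =
   (F n.+1%:R - F (- n.+1%:R))%:E +
   (s ^+ 2 + c ^+ 2)%:E * \int[mu]_(x in I n) (phi x)%:E)%E.
Proof.
have icont g : continuous g -> mu.-integrable (I n) (EFin \o g).
  move=> cg; apply: continuous_compact_integrable; first exact: segment_compact.
  exact: continuous_subspaceT.
have mI : measurable (I n) by exact: measurable_itv.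
rewrite EFinB -(@continuous_FTC2 _ f).
- rewrite -integralZl//=; last exact: icont.
  rewrite -integralD//=.
  + by apply: eq_integral => x _; rewrite -!EFinM -EFinD /f; congr EFin; ring.
  + exact: icont.
  + by apply: integrableZl => //; exact: icont.
- by rewrite (@lt_trans _ _ 0) ?oppr_lt0 ?ltr0n.
- exact: continuous_subspaceT.
- have dF x : derivable F x 1 by case: (is_derive_F x).
  have cF : continuous F by move=> x; exact/differentiable_continuous/derivable1_diffP.
  by split => //; [exact/cvg_at_right_filter/cF|exact/cvg_at_left_filter/cF].
- by move=> x _; rewrite derive1E; case: (is_derive_F x).
Qed.

(** Monotone convergence along the intervals [I n]: the boundary terms of [F] vanish and the
    integral of [phi] tends to 1. *)
Lemma integral_sqr_normal_pdf :
  (\int[mu]_x (((x + c) ^+ 2)%:E * (phi x)%:E) = (s ^+ 2 + c ^+ 2)%:E)%E.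
Proof.
have mphi : measurable_fun setT phi by exact: measurable_normal_pdf.
have mg : measurable_fun [set: R] (fun x : R => ((x + c) ^+ 2)%:E * (phi x)%:E)%E.
  apply: emeasurable_funM; apply/measurable_EFinP => //.
  by apply: measurable_funX; exact: measurable_funD.
have cvg_I (g : measurableTypeR R -> \bar R) : measurable_fun setT g -> (forall x, 0 <= g x)%E ->
    (\int[mu]_(x in I n) g x)%E @[n --> \oo] --> (\int[mu]_x g x)%E.
  move=> mg' g0; rewrite -bigcup_I.
  apply: ge0_nondecreasing_set_cvg_integral => // i; first exact: measurable_itv.
  exact: measurable_funTS.
have g0 (x : R) : (0 <= ((x + c) ^+ 2)%:E * (phi x)%:E)%E.
  by rewrite mule_ge0// lee_fin ?sqr_ge0 ?normal_pdf_ge0.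
have L := cvg_I _ mg g0.
have mphiE : measurable_fun setT (EFin \o phi) by exact/measurable_EFinP.
have L1 := cvg_I _ mphiE (normal_pdf_ge0 0 s).
rewrite /= integral_normal_pdf in L1.
apply: (cvg_unique _ L) => //=.
under eq_fun do rewrite integral_I.
rewrite -[X in nbhs X]add0e -[X in nbhs (_ + X)%E]mule1.
apply: cvgeD => //; first by apply: cvg_EFin; [exact: nearW|exact: F_cvg0].
exact: cvgeZl.
Qed.
End normal_moments.

Section gaussian_increment.
Context {R : realType}.
Local Open Scope ereal_scope.

Lemma integral_sqr_centered_gaussian (m : {measure set (measurableTypeR R) -> \bar R}) (v c : R) :
  (0 <= v)%R ->
  (forall B, measurable B -> m B = centered_gaussian v B) ->
  \int[m]_x ((c + x) ^+ 2)%:E = (c ^+ 2 + v)%:E.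
Proof.
rewrite /centered_gaussian => v0 mE.
have mf : measurable_fun [set: measurableTypeR R] (fun x : measurableTypeR R => ((c + x) ^+ 2)%:E).
  by apply/measurable_EFinP; apply: measurable_funX; exact: measurable_funD.
(* For variance 0 the law is the Dirac mass at 0, and the integral is [c^2]. *)
case: eqP mE => [->|/eqP v1] mE.
  rewrite (@eq_measure_integral _ _ _ _ (@dirac _ (measurableTypeR R) 0%R R)); last first.
    by move=> A mA _; exact: mE.
  by rewrite integral_dirac//= diracT mul1e addr0 addr0.
have s0 : Num.sqrt v != 0%R by rewrite gt_eqF// sqrtr_gt0 lt_def v1.
rewrite (@eq_measure_integral _ _ _ _ (normal_prob 0 (Num.sqrt v))); last first.
  by move=> A mA _; exact: mE.
rewrite ge0_integral_normal_prob//; last by move=> x; rewrite lee_fin sqr_ge0.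
under eq_integral do rewrite addrC.
by rewrite integral_sqr_normal_pdf// sqr_sqrtr// addrC.
Qed.

(* Everything being nonnegative, Tonelli applies and [X] need not be square
   integrable. *)
Lemma integral_sqr_add_gaussian d (T : measurableType d) (P : probability T R)
    (X Z : T -> R) (v : R) : (0 <= v)%R ->
  measurable_fun setT X -> measurable_fun setT Z ->
  (forall A B, measurable A -> measurable B ->
    P (X @^-1` A `&` Z @^-1` B) = P (X @^-1` A) * P (Z @^-1` B)) ->
  (forall B, measurable B -> P (Z @^-1` B) = centered_gaussian v B) ->
  \int[P]_w ((X w + Z w) ^+ 2)%:E = \int[P]_w (X w ^+ 2)%:E + v%:E.
Proof.
move=> v0 mX mZ indep law.
pose E := measurableTypeR R.
pose X1 : T -> E := X; pose Z1 : T -> E := Z.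
have mX1 : measurable_fun setT X1 by [].
have mZ1 : measurable_fun setT Z1 by [].
have mXZ : measurable_fun setT (fun w => (X1 w, Z1 w)) by exact: measurable_fun_pair.
pose X' : {mfun T >-> E} := HB.pack X1 (isMeasurableFun.Build _ _ _ _ X1 mX1).
pose Z' : {mfun T >-> E} := HB.pack Z1 (isMeasurableFun.Build _ _ _ _ Z1 mZ1).
pose XZ : {mfun T >-> (E * E)%type} :=
  HB.pack (fun w => (X1 w, Z1 w)) (isMeasurableFun.Build _ _ _ _ (fun w => (X1 w, Z1 w)) mXZ).
pose h (z : E * E) := (((z.1 : R) + z.2) ^+ 2)%:E.
have mh : measurable_fun [set: E * E] h.
  by apply/measurable_EFinP; apply: measurable_funX; apply: measurable_funD;
    [exact: measurable_fst|exact: measurable_snd].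
have h0 z : 0 <= h z by rewrite lee_fin sqr_ge0.
transitivity (\int[distribution P XZ]_z h z).
  by rewrite ge0_integral_distribution.
transitivity (\int[distribution P X' \x distribution P Z']_z h z).
  (* By independence the joint law and the product of the laws agree on rectangles, hence on all
     measurable sets. *)
  apply: eq_measure_integral => A mA _.
  by apply/esym/product_measure_unique => // B C mB mC; exact: indep.
rewrite fubini_tonelli1//= /fubini_F.
transitivity (\int[distribution P X']_x ((x ^+ 2)%:E + v%:E)).
  by apply: eq_integral => x _; rewrite -EFinD;
    exact: (@integral_sqr_centered_gaussian (distribution P Z') v x v0 law).
rewrite ge0_integral_distribution//=; last 2 first.
- apply: emeasurable_funD => //; apply/measurable_EFinP.
  exact: (@measurable_funX _ E R setT (fun x => x) 2).
- by move=> x; rewrite -EFinD lee_fin addr_ge0 ?sqr_ge0.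
rewrite ge0_integralD//=.
- by rewrite integral_cst//= probability_setT mule1.
- by move=> w _; rewrite lee_fin sqr_ge0.
- by apply/measurable_EFinP; exact: measurable_funX.
Qed.
End gaussian_increment.

(** * The finite element space in L2 *)

Section finite_domain.
Context {R : realType}.

Definition cube n (M : R) : set 'rV[R]_n := [set x | forall i, `|x 0 i| <= M].

Lemma measurable_cube n M : measurable (@cube n M).
Proof.
have -> : @cube n M = \bigcap_(i in [set: 'I_n]) ((fun x : 'rV[R]_n => x 0 i) @^-1` `[- M, M]).
  apply/seteqP; split => x xM i; first by move=> _; rewrite /= in_itv /= -ler_norml.
  by have := xM i I; rewrite /= in_itv /= -ler_norml.
apply: fin_bigcap_measurable => // i _.
rewrite -[X in measurable X]setTI.
have := @measurable_rv_coord R n i; apply => //; exact: measurable_itv.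
Qed.

Lemma leb_cube_lty n M : (leb n (@cube n M) < +oo :> \bar R)%E.
Proof.
elim: n => [|n IH]; first by rewrite /= diracE; case: (_ \in _); rewrite ltry.
rewrite /= /leb_step.
have -> : @rv_cons R n @^-1` @cube n.+1 M = `[- M, M] `*` @cube n M.
  apply/seteqP; split => [z zM|z [/= zM1 zM2] i].
    split => [|i] /=; first by rewrite in_itv /= -ler_norml -rv_cons0.
    by rewrite -rv_consS.
  case: (unliftP ord0 i) => [j ->|->]; first by rewrite rv_consS.
  by rewrite rv_cons0 ler_norml; rewrite in_itv in zM1.
rewrite product_measure1E//; last exact: measurable_cube.
by rewrite lte_mul_pinfty// [X in X \is a _]lebesgue_measure_itv; case: ifP.
Qed.

Context {d : nat} (G : seq ('rV[R]_d * R)) (domG : polytopal_domain G).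
Local Notation mu := (domain_measure G).

Lemma polytope_sub_cube : exists M, polytope G `<=` cube M.
Proof.
(* Boundedness provides a bound only for constants strictly above [M], whence [M + 1]. *)
have [_ [M [_ bM]]] := domG; exists (M + 1) => x Gx i.
rewrite (le_trans _ (bM (M + 1) _ x Gx)) ?ltrDl//.
by rewrite [leRHS]mx_normrE (le_bigmax _ (fun ij => `|x ij.1 ij.2|) (0, i)).
Qed.

Lemma domain_measure_lty : (mu setT < +oo)%E.
Proof.
have [M GM] := polytope_sub_cube; rewrite /= /mrestr setTI.
apply: le_lt_trans (leb_cube_lty d M).
by apply: le_measure => //; rewrite inE; [exact: measurable_polytope|exact: measurable_cube].
Qed.

(** Polynomials are bounded only on the polytope, whose complement has measure 0 for
    [domain_measure G]. *)
Definition bounded_on (f : 'rV[R]_d -> R) :=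
  exists M, forall x, polytope G x -> `|f x| <= M.

Lemma bounded_onD f g : bounded_on f -> bounded_on g -> bounded_on (fun x => f x + g x).
Proof.
move=> [M fM] [N gN]; exists (M + N) => x Gx.
by rewrite (le_trans (ler_normD _ _))// lerD ?fM ?gN.
Qed.

Lemma bounded_onM f g : bounded_on f -> bounded_on g -> bounded_on (fun x => f x * g x).
Proof.
move=> [M fM] [N gN]; exists (M * N) => x Gx.
by rewrite normrM ler_pM ?fM ?gN.
Qed.

Lemma bounded_on_cst c : bounded_on (fun=> c).
Proof. by exists `|c|. Qed.

Lemma bounded_on_Lfun2 f : measurable_fun setT f -> bounded_on f -> f \in Lfun mu 2%:E.
Proof.
move=> mf [M fM]; rewrite inE; apply/andP; split; rewrite inE//=.
rewrite /finite_norm unlock poweR_lty//.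
have mfM : measurable_fun setT (fun x => (`|f x| `^ 2)%:E).
  apply/measurable_EFinP; apply: (@measurableT_comp _ _ _ _ _ _ (fun x : R => x `^ 2)) => //.
  exact: measurableT_comp.
apply: (@le_lt_trans _ _ (\int[mu]_x (M `^ 2)%:E))%E.
  apply: ae_ge0_le_integral => //=.
    by move=> x _; rewrite lee_fin powR_ge0.
  have neg : mu.-negligible (~` polytope G).
    exists (~` polytope G); split => //.
      by apply: measurableC; exact: measurable_polytope.
    by rewrite /= /mrestr setICl measure0.
  apply: negligibleS neg => x /= h Gx; apply: h => _; rewrite lee_fin.
  by apply: ge0_ler_powR => //; rewrite ?nnegrE// ?fM// (le_trans _ (fM _ Gx)).
rewrite integral_cst//=; rewrite lte_mul_pinfty// ?lee_fin ?powR_ge0//.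
exact: domain_measure_lty.
Qed.
End finite_domain.

Section L2_form.
Context {R : realType} {d : nat} (G : seq ('rV[R]_d * R)).
Local Notation mu := (domain_measure G).

Lemma L2_Lfun (f : L2 G) : (f : 'rV[R]_d -> R) \in Lfun mu 2%:E.
Proof. exact: LfunP. Qed.

Lemma integrable_mul_L2 (f g : L2 G) : mu.-integrable setT (EFin \o (fun x => f x * g x)).
Proof. by apply/Lfun1_integrable/Lfun2_mul_Lfun1; exact: L2_Lfun. Qed.

Lemma l2dot_psd_form : psd_form (fun f g : L2 G => l2dot G f g).
Proof.
split => [a f g h|f g|f].
- rewrite /l2dot -RintegralZl//; last exact: integrable_mul_L2.
  rewrite -RintegralD//; last 2 first.
  + have := integrable_mul_L2 (a *: f) h; apply: eq_integrable => // x _ /=.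
    by rewrite mulrA.
  + exact: integrable_mul_L2.
  by apply: eq_Rintegral => x _ /=; rewrite mulrDl mulrA.
- by rewrite /l2dot; apply: eq_Rintegral => x _; rewrite mulrC.
- by apply: Rintegral_ge0 => x _; exact: sqr_ge0.
Qed.

Lemma l2norm_sqr (f : L2 G) : l2norm G f ^+ 2 = l2dot G f f.
Proof. by rewrite sqr_sqrtr// (form_ge0 l2dot_psd_form). Qed.

(** Needed because [sqrt_operator] identifies the square of [Qhalf] with [Q] only almost
    everywhere. *)
Lemma eq_l2dot (f f' g : L2 G) : (f : 'rV[R]_d -> R) = f' %[ae mu] -> l2dot G f g = l2dot G f' g.
Proof.
move=> ff'; congr fine; apply: ae_eq_integral => //.
- exact: measurable_int (integrable_mul_L2 f g).
- exact: measurable_int (integrable_mul_L2 f' g).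
by apply: filterS ff' => x ff' _; rewrite ff'.
Qed.
End L2_form.

(** With invertible edges, the interior is the preimage of a polytope under the inverse affine
    map. *)
Lemma measurable_cell_interior (R : realType) d (K : cell R d) :
  cell_edges K \in unitmx -> measurable (cell_interior K).
Proof.
move=> uK; pose f (x : 'rV[R]_d) := (x - cell_org K) *m invmx (cell_edges K).
have -> : cell_interior K = f @^-1` polytope (ref_constraints K).
  apply/seteqP; split => [_ [s sK <-]|x xK] /=.
    by rewrite /f /cell_map addrC addKr mulmxK.
  by exists (f x) => //; rewrite /cell_map /f mulmxKV// addrC subrK.
rewrite -[X in measurable X]setTI.
suff mf : measurable_fun setT f by apply: mf => //; exact: measurable_polytope.
apply: measurable_rvP => i; under eq_fun do rewrite mxE.
apply: measurable_sum => j; apply: measurable_funM => //.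
under eq_fun do rewrite !mxE.
by apply: measurable_funB => //; exact: measurable_rv_coord.
Qed.

(** * Finite element functions as elements of L2 *)

Section dg_form.
Context {R : realType} {d p : nat} (G : seq ('rV[R]_d * R)) (domG : polytopal_domain G).
Context (T : mesh R d) (meshT : mesh_of G T).
Local Notation V := (dgspace p T).
Local Notation mu := (domain_measure G).

Lemma bounded_on_sum (I : Type) (r : seq I) (F : I -> 'rV[R]_d -> R) :
  (forall i, bounded_on G (F i)) -> bounded_on G (fun x => \sum_(i <- r) F i x).
Proof.
move=> bF; elim: r => [|i r IH].
  by under eq_fun do rewrite big_nil; exact: bounded_on_cst.
by under eq_fun do rewrite big_cons; exact: bounded_onD.
Qed.

Lemma bounded_on_prod (I : Type) (r : seq I) (F : I -> 'rV[R]_d -> R) :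
  (forall i, bounded_on G (F i)) -> bounded_on G (fun x => \prod_(i <- r) F i x).
Proof.
move=> bF; elim: r => [|i r IH].
  by under eq_fun do rewrite big_nil; exact: bounded_on_cst.
by under eq_fun do rewrite big_cons; exact: bounded_onM.
Qed.

Lemma measurable_poly_eval (q : poly_space R d p) : measurable_fun setT (poly_eval q).
Proof.
apply: measurable_sum => a; apply: measurable_funM => //.
apply: measurable_prod => i _; apply: measurable_funX; exact: measurable_rv_coord.
Qed.

Lemma bounded_on_poly_eval (q : poly_space R d p) : bounded_on G (poly_eval q).
Proof.
apply: bounded_on_sum => a; apply: bounded_onM; first exact: bounded_on_cst.
apply: bounded_on_prod => i; have [M GM] := polytope_sub_cube domG.
by exists (M ^+ val a i) => x Gx; rewrite normrX lerXn2r ?nnegrE// (le_trans _ (GM _ Gx i)).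
Qed.

Lemma dgfun_Lfun2 (u : V) : dgfun u \in Lfun mu 2%:E.
Proof.
apply: bounded_on_Lfun2 => //.
  apply: measurable_sum => i; apply: measurable_funM; last exact: measurable_poly_eval.
  by apply: measurable_indic; apply: measurable_cell_interior; case: meshT.
apply: bounded_on_sum => i; apply: bounded_onM; last exact: bounded_on_poly_eval.
by exists 1 => x _; rewrite indicE; case: (_ \in _); rewrite ?normr1 ?normr0.
Qed.

Definition dgL2 (u : V) : L2 G := Lfun_Sub (lee1n 2) (dgfun_Lfun2 u).

Lemma dgL2E u : (dgL2 u : 'rV[R]_d -> R) = dgfun u. Proof. by []. Qed.

Lemma dgL2_linear a u v : dgL2 (a *: u + v) = a *: dgL2 u + dgL2 v.
Proof.
apply/LfuneqP => x; transitivity (a * dgfun u x + dgfun v x); last by [].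
rewrite /= /dgfun mulr_sumr -big_split; apply: eq_bigr => i _ /=.
rewrite mulrCA -mulrDr; congr (_ * _).
rewrite /poly_eval mulr_sumr -big_split; apply: eq_bigr => c _ /=.
by rewrite /dg_restr !ffunE mulrDl mulrA.
Qed.

(** The form is pulled back from [l2dot] along the linear map [dgL2]. *)
Lemma dgdot_psd_form : psd_form (fun u v : V => dgdot G u v).
Proof.
have H := l2dot_psd_form G.
split => [a u v w|u v|u]; rewrite /dgdot -!dgL2E.
- by rewrite dgL2_linear (formDl H) (formZl H).
- exact: (formC H).
- exact: (form_ge0 H).
Qed.

Lemma dgnorm_sqr (u : V) : dgnorm G u ^+ 2 = dgdot G u u.
Proof. by rewrite sqr_sqrtr// (form_ge0 dgdot_psd_form). Qed.

Definition dg_delta (i : 'I_(ncells T)) (a : multi_index d p) : V :=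
  [ffun j => if j == i then [ffun c => (c == a)%:R] else 0].

Lemma dg_sum_delta (u : V) :
  u = \sum_i \sum_a (dg_restr u i : {ffun _ -> R^o}) a *: dg_delta i a.
Proof.
apply/ffunP => j; rewrite sum_ffunE (bigD1 j)//= [X in _ + X]big1 => [|i ij].
  rewrite addr0 sum_ffunE; apply/ffunP => c; rewrite sum_ffunE (bigD1 c)//=.
  rewrite big1 => [|a ac]; first by (rewrite !ffunE eqxx ffunE eqxx addr0; exact/esym/mulr1).
  by rewrite !ffunE eqxx ffunE eq_sym (negbTE ac); exact: mulr0.
rewrite sum_ffunE big1// => a _; rewrite !ffunE eq_sym (negbTE ij).
exact: scaler0.
Qed.
End dg_form.

(** * Stochastic position Verlet *)

Section parseval.
Context {R : realType} {d : nat} (G : seq ('rV[R]_d * R)).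
Context (e : nat -> L2 G) (onb : orthonormal_basis e).
Let b (f g : L2 G) := l2dot G f g.
Let pb : psd_form b := l2dot_psd_form G.

(** The squared distance from [f] to its partial expansion is [(f, f)] minus the partial sum, and it
    tends to 0. *)
Lemma parseval (f : L2 G) :
  (\sum_(k <oo) (l2dot G (e k) f ^+ 2)%:E = (l2dot G f f)%:E)%E.
Proof.
have [ortho /(_ f) cvgf] := onb.
pose S n : L2 G := \sum_(k < n) l2dot G f (e k) *: e k.
have bS n g : b (S n) g = \sum_(k < n) b f (e k) * b (e k) g.
  by rewrite (form_suml pb); apply: eq_bigr => k _; rewrite (formZl pb).
have beS n (k : 'I_n) : b (e k) (S n) = b f (e k).
  rewrite (formC pb) bS (bigD1 k)//= big1 ?addr0 => [|i ik]; last first.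
    by rewrite /b ortho (inj_eq val_inj) (negbTE ik) mulr0.
  by rewrite /b ortho eqxx mulr1.
have nE n : l2norm G (f - S n : L2 G) ^+ 2 = b f f - \sum_(k < n) b (e k) f ^+ 2.
  have Sf : b (S n) f = \sum_(k < n) b (e k) f ^+ 2.
    by rewrite bS; apply: eq_bigr => k _; rewrite (formC pb f) expr2.
  have SS : b (S n) (S n) = \sum_(k < n) b (e k) f ^+ 2.
    by rewrite bS; apply: eq_bigr => k _; rewrite beS (formC pb f) expr2.
  rewrite l2norm_sqr -[LHS]/(b _ _) !(formE pb) (formC pb f (S n)) SS Sf; ring.
have L : \sum_(k < n) b (e k) f ^+ 2 @[n --> \oo] --> b f f.
  have : b f f - l2norm G (f - S n : L2 G) ^+ 2 @[n --> \oo] --> b f f - 0 * 0.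
    by apply: cvgB; [exact: cvg_cst|apply: cvgM].
  rewrite mulr0 subr0; apply: cvg_trans.
  by apply: near_eq_cvg; apply: nearW => n /=; rewrite nE; ring.
apply/cvg_lim => //; apply/fine_cvgP; split.
  by apply: nearW => n; rewrite sumEFin.
apply: cvg_trans L; apply: near_eq_cvg; apply: nearW => n /=.
by rewrite sumEFin big_mkord.
Qed.

(** Self-adjointness moves [Qhalf] onto [g]; Parseval then gives the squared norm of [Qhalf g],
    which is [(Q g, g)]. *)
Lemma parseval_sqrt (Q Qhalf : L2 G -> L2 G) (g : L2 G) :
  sqrt_operator Q Qhalf ->
  (\sum_(k <oo) (l2dot G (Qhalf (e k)) g ^+ 2)%:E = (l2dot G (Q g) g)%:E)%E.
Proof.
move=> [[_ sym _] sq]; rewrite -(eq_l2dot g (sq g)) sym -parseval.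
by apply: eq_eseriesr => k _; rewrite sym.
Qed.
End parseval.

(** * Measurability along the filtration and Wiener increments *)

Section measurable_wrt.
Context {R : realType} {Omega : pointedType} (H : set (set Omega)) (sH : sigma_algebra setT H).

(** A sigma-algebra generates itself, so the closure properties of measurable functions transfer to
    [measurable_wrt]. *)
Lemma measurable_wrtP (X : Omega -> R) :
  measurable_wrt H X <-> measurable_fun setT (X : g_sigma_algebraType H -> R).
Proof.
have mE : @measurable _ (g_sigma_algebraType H) = H by exact: sigma_algebra_id.
split => [mX _ B mB|mX B mB]; first by rewrite setTI mE; exact: mX.
by rewrite -mE -[X in measurable X]setTI; exact: mX.
Qed.

Lemma measurable_wrtD (X Y : Omega -> R) :
  measurable_wrt H X -> measurable_wrt H Y -> measurable_wrt H (fun w => X w + Y w).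
Proof.
move=> /measurable_wrtP mX /measurable_wrtP mY; apply/measurable_wrtP.
exact: measurable_funD.
Qed.

Lemma measurable_wrtZ a (X : Omega -> R) :
  measurable_wrt H X -> measurable_wrt H (fun w => a * X w).
Proof. by move=> /measurable_wrtP mX; apply/measurable_wrtP; exact: measurable_funM. Qed.

Lemma measurable_wrt_sum (I : Type) (r : seq I) (X : I -> Omega -> R) :
  (forall i, measurable_wrt H (X i)) -> measurable_wrt H (fun w => \sum_(i <- r) X i w).
Proof.
move=> mX; apply/measurable_wrtP; apply: measurable_sum => i.
exact/measurable_wrtP.
Qed.
End measurable_wrt.

Section wiener_increment.
Context {R : realType} {dd : measure_display} {Omega : measurableType dd}.
Context {P : probability Omega R} {F : R -> set (set Omega)} (nF : normal_filtration P F).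
Context {d : nat} {G : seq ('rV[R]_d * R)} {Q : L2 G -> L2 G} (psdQ : psd_operator Q).
Context {W : R -> Omega -> L2 G} (wW : wiener_process P F Q W).

Lemma measurable_wiener t (g : L2 G) : 0 <= t ->
  measurable_wrt (F t) (fun w => l2dot G (W t w) g).
Proof.
move=> t0 B mB; have [_ _ gen _ _] := wW.
by apply: gen t0 _ _; apply: sub_sigma_algebra; exists g, B.
Qed.

Lemma measurable_increment s t (g : L2 G) : 0 <= s -> s <= t ->
  measurable_wrt (F t) (fun w => l2dot G (W t w - W s w : L2 G) g).
Proof.
move=> s0 st; have t0 := le_trans s0 st.
have [sub mono _ _] := nF.
have pb := l2dot_psd_form G.
have -> : (fun w => l2dot G (W t w - W s w : L2 G) g) =
    (fun w => l2dot G (W t w) g + -1 * l2dot G (W s w) g).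
  by apply/funext => w; rewrite (formDl pb) (formNl pb) mulN1r.
have [sF _] := sub t t0.
apply: (measurable_wrtD sF); first exact: measurable_wiener.
apply: (measurable_wrtZ sF) => B mB; apply: (mono _ _ s0 st).
exact: measurable_wiener.
Qed.

Lemma integral_sqr_add_increment s t (g : L2 G) (X : Omega -> R) :
  0 <= s -> s <= t -> measurable_wrt (F s) X ->
  (\int[P]_w ((X w + l2dot G (W t w - W s w : L2 G) g) ^+ 2)%:E =
   \int[P]_w (X w ^+ 2)%:E + ((t - s) * l2dot G (Q g) g)%:E)%E.
Proof.
move=> s0 st mX; have t0 := le_trans s0 st.
have [sub mono _ _] := nF; have [_ _ _ indep law] := wW.
apply: integral_sqr_add_gaussian.
- by have [_ _ Q0] := psdQ; rewrite mulr_ge0// subr_ge0.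
- by move=> _ B mB; rewrite setTI; apply: (sub s s0).2; exact: mX.
- by move=> _ B mB; rewrite setTI; apply: (sub t t0).2; exact: measurable_increment.
- move=> A B mA mB; apply: indep s0 st _ _ _ _; first exact: mX.
  by apply: sub_sigma_algebra; exists g, B.
- by move=> B mB; exact: law.
Qed.
End wiener_increment.

(** * Energies as sums of squared functionals, and their expectations *)

Section verlet_expectation.
Context {R : realType} {d p : nat} (G : seq ('rV[R]_d * R)) (domG : polytopal_domain G).
Context (T : mesh R d) (meshT : mesh_of G T).
Local Notation V := (dgspace p T).
Implicit Types (u v : V) (Y phi : V * V).

Let pV : psd_form (fun u v : V => dgdot G u v) := dgdot_psd_form domG meshT.

(* The functionals in which the energies are sums of squares; their measurability
   is what the filtration argument propagates. *)
Definition pairing Y phi : R := dgdot G Y.1 phi.1 + dgdot G Y.2 phi.2.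

Lemma pairingDl Y Z phi : pairing (Y + Z) phi = pairing Y phi + pairing Z phi.
Proof. by rewrite /pairing /= !(formDl pV) addrACA. Qed.

Lemma dg_sum_squares : exists s : seq V, forall u, dgdot G u u = \sum_(v <- s) dgdot G u v ^+ 2.
Proof. exact: psd_form_sum_squares. Qed.

(** Self-adjointness moves [M] and [S] onto the fixed vectors of [dg_sum_squares]. Keeping [M]
    general covers the discrete energy too, with [M] the identity. *)
Lemma modified_norm2_sum_squares (M S : 'End(V)) :
  (forall u v, dgdot G (S u) v = dgdot G u (S v)) ->
  (forall u v, dgdot G (M u) v = dgdot G u (M v)) ->
  exists s : seq (V * V), forall Y,
    modified_norm2 G M S Y = \sum_(phi <- s) 2^-1 * pairing Y phi ^+ 2.
Proof.
move=> symS symM; have [s sP] := dg_sum_squares.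
exists ([seq (S (M v), 0) | v <- s] ++ [seq (0, v) | v <- s]) => Y.
rewrite big_cat !big_map /= -!mulr_sumr /modified_norm2 !dgnorm_sqr// !sP.
congr (_ * _ + _ * _); apply: eq_bigr => v _; congr (_ ^+ 2); rewrite /pairing /=.
  by rewrite (formC pV Y.2) (form0l pV) addr0 symM symS.
by rewrite (formC pV Y.1) (form0l pV) add0r.
Qed.

Lemma pairing_verlet_M tau (Lam : 'End(V)) phi :
  (forall u v, dgdot G (Lam u) v = dgdot G u (Lam v)) ->
  exists phi', forall Y, pairing (verlet_M tau Lam Y) phi = pairing Y phi'.
Proof.
move=> sym; exists (phi.1 - (tau ^+ 2 / 2) *: Lam phi.1 - tau *: Lam phi.2,
  tau *: phi.1 - (tau ^+ 3 / 4) *: Lam phi.1 + (phi.2 - (tau ^+ 2 / 2) *: Lam phi.2)) => Y.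
exact: (verlet_adjoint _ _ _ _ _ _ _ pV sym).
Qed.

(** [(tau / 2) *: phi.1 + phi.2] is the transpose of [D] applied to [phi]: each functional sees the
    noise through one fixed element of L2. *)
Lemma pairing_verlet_D tau (Ph : L2 G -> V) : l2_projection Ph -> forall phi (f : L2 G),
  pairing (verlet_D tau (Ph f)) phi =
  l2dot G f (dgL2 domG meshT ((tau / 2) *: phi.1 + phi.2)).
Proof.
move=> PhP phi f; rewrite /pairing /= (formZl pV) -(formZr pV) -(formDr pV).
by rewrite PhP.
Qed.
End verlet_expectation.

Section position_verlet.
Context {R : realType} {d p : nat} {G : seq ('rV[R]_d * R)} (domG : polytopal_domain G).
Context {T : mesh R d} (meshT : mesh_of G T).
Local Notation V := (dgspace p T).
Context {dd : measure_display} {Omega : measurableType dd}.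
Context {P : probability Omega R} {F : R -> set (set Omega)} (nF : normal_filtration P F).

Let pV : psd_form (fun u v : V => dgdot G u v) := dgdot_psd_form domG meshT.

Definition adapted (H : set (set Omega)) (Y : Omega -> V * V) :=
  forall phi, measurable_wrt H (fun w => pairing G (Y w) phi).

(** Expanding in the monomials of each cell turns measurable coefficients into measurable inner
    products. *)
Lemma random_variable_adapted t (Y : Omega -> V * V) : 0 <= t ->
  dg_random_variable (F t) Y -> adapted (F t) Y.
Proof.
move=> t0 mY phi; have [/(_ t t0)[sF _] _ _ _] := nF.
have coord (X : Omega -> V) v :
    (forall i a, measurable_wrt (F t) (fun w => (dg_restr (X w) i : {ffun _ -> R^o}) a)) ->
    measurable_wrt (F t) (fun w => dgdot G (X w) v).
  move=> mX; have -> : (fun w => dgdot G (X w) v) = (fun w => \sum_i \sum_a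
      dgdot G (dg_delta i a) v * (dg_restr (X w) i : {ffun _ -> R^o}) a).
    apply/funext => w; rewrite {1}(dg_sum_delta (X w)) (form_suml pV).
    apply: eq_bigr => i _; rewrite (form_suml pV); apply: eq_bigr => a _.
    by rewrite (formZl pV) mulrC.
  do 2 (apply: (measurable_wrt_sum sF) => ?).
  exact: (measurable_wrtZ sF).
by apply: (measurable_wrtD sF); apply: coord => i a; have [] := mY i a.
Qed.

Context {Q : L2 G -> L2 G} (psdQ : psd_operator Q).
Context {W : R -> Omega -> L2 G} (wW : wiener_process P F Q W).
Context {Ph : L2 G -> V} (PhP : l2_projection Ph).
Context {tau : R} (tau_gt0 : 0 < tau) {Lam : 'End(V)}.
Context (Lam_sym : forall u v, dgdot G (Lam u) v = dgdot G u (Lam v)).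
Context {Y0 : Omega -> V * V} (mY0 : dg_random_variable (F 0) Y0).
Local Notation Y := (position_verlet tau Lam Ph W Y0).
Local Notation dual phi := (dgL2 domG meshT ((tau / 2) *: phi.1 + phi.2)).

Let tn_ge0 n : 0 <= n%:R * tau.
Proof. by rewrite mulr_ge0// ltW. Qed.

Let tn_le n : n%:R * tau <= n.+1%:R * tau.
Proof. by rewrite ler_pM2r// ler_nat. Qed.

Lemma position_verlet_adapted n : adapted (F (n%:R * tau)) (Y n).
Proof.
have [sub mono _ _] := nF.
elim: n => [|n IH] phi.
  by rewrite mul0r; exact: random_variable_adapted.
have [sF _] := sub _ (tn_ge0 n.+1).
have [phi' phiE] := pairing_verlet_M domG meshT tau phi Lam_sym.
have -> : (fun w => pairing G (Y n.+1 w) phi) = (fun w => pairing G (Y n w) phi' +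
    l2dot G (W (n.+1%:R * tau) w - W (n%:R * tau) w : L2 G) (dual phi)).
  apply/funext => w; rewrite [Y n.+1 w]/= (pairingDl domG meshT) phiE.
  by rewrite (pairing_verlet_D domG meshT _ PhP).
apply: (measurable_wrtD sF).
  by move=> B mB; apply: (mono _ _ (tn_ge0 n) (tn_le n)); exact: IH.
exact: (measurable_increment nF wW).
Qed.

Lemma measurable_position_verlet n phi :
  measurable_fun setT (fun w => pairing G (Y n w) phi).
Proof.
move=> _ B mB; rewrite setTI; have [/(_ _ (tn_ge0 n))[_ sub] _ _ _] := nF.
by apply: sub; exact: position_verlet_adapted.
Qed.

Local Notation sumsq s v := (\sum_(phi <- s) 2^-1 * pairing G v phi ^+ 2).

Lemma expectation_sum_squares (s : seq (V * V)) (Z : Omega -> V * V) :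
  (forall phi, measurable_fun setT (fun w => pairing G (Z w) phi)) ->
  ('E_P[fun w => sumsq s (Z w)] =
   \sum_(phi <- s) 2^-1%:E * \int[P]_w (pairing G (Z w) phi ^+ 2)%:E)%E.
Proof.
move=> mZ; have mZ2 phi : measurable_fun setT (fun w => (pairing G (Z w) phi ^+ 2)%:E).
  by apply/measurable_EFinP; exact: measurable_funX.
rewrite unlock; under eq_integral do rewrite -sumEFin.
rewrite ge0_integral_sum//.
- apply: eq_bigr => phi _; under eq_integral do rewrite EFinM.
  by rewrite ge0_integralZl// => w _; rewrite lee_fin sqr_ge0.
- by move=> phi; apply/measurable_EFinP; apply: measurable_funM => //; exact: measurable_funX.
- by move=> phi w _; rewrite lee_fin mulr_ge0// sqr_ge0.
Qed.

Lemma expectation_position_verlet (s : seq (V * V)) n :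
  (forall v, sumsq s (verlet_M tau Lam v) = sumsq s v) ->
  ('E_P[fun w => sumsq s (Y n w)] = 'E_P[fun w => sumsq s (Y0 w)] +
   (n%:R * tau * \sum_(phi <- s) 2^-1 * l2dot G (Q (dual phi)) (dual phi))%:E)%E.
Proof.
move=> inv; elim: n => [|n IH]; first by rewrite !mul0r adde0.
rewrite [in LHS]expectation_sum_squares; last exact: measurable_position_verlet.
(* The Verlet step stays inside the pairing because [inv] holds for the whole sum, not for single
   squares; [phi'] serves only to show that the pairing is measurable at time [t_n]. *)
transitivity (\sum_(phi <- s)
  (2^-1%:E * \int[P]_w (pairing G (verlet_M tau Lam (Y n w)) phi ^+ 2)%:E +
   (tau * (2^-1 * l2dot G (Q (dual phi)) (dual phi)))%:E))%E.
  apply: eq_bigr => phi _.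
  have [phi' phiE] := pairing_verlet_M domG meshT tau phi Lam_sym.
  under eq_integral => w _.
    rewrite [Y n.+1 w]/= (pairingDl domG meshT) phiE.
    rewrite (pairing_verlet_D domG meshT _ PhP).
    over.
  rewrite (integral_sqr_add_increment nF psdQ wW _ (tn_ge0 n) (tn_le n)); last first.
    exact: position_verlet_adapted.
  rewrite ge0_muleDr ?integral_ge0// => [|w _|]; last 2 first.
  - by rewrite lee_fin sqr_ge0.
  - have [_ _ Q0] := psdQ.
    by rewrite lee_fin mulr_ge0// subr_ge0.
  have -> : (\int[P]_w (pairing G (verlet_M tau Lam (Y n w)) phi ^+ 2)%:E =
      \int[P]_w (pairing G (Y n w) phi' ^+ 2)%:E)%E.
    by apply: eq_integral => w _; rewrite phiE.
  by rewrite -EFinM -mulrBl -natrB// subSnn mul1r mulrCA.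
rewrite big_split /= -expectation_sum_squares; last first.
  move=> phi; have [phi' phiE] := pairing_verlet_M domG meshT tau phi Lam_sym.
  by under eq_fun do rewrite phiE; exact: measurable_position_verlet.
under eq_fun do rewrite inv.
rewrite IH sumEFin -addeA -EFinD; congr (_ + _%:E)%E.
have -> : \sum_(phi <- s) tau * (2^-1 * l2dot G (Q (dual phi)) (dual phi)) =
    tau * \sum_(phi <- s) 2^-1 * l2dot G (Q (dual phi)) (dual phi).
  by rewrite mulr_sumr.
move: (\sum_(phi <- s) _) => S; rewrite -(natr1 n); ring.
Qed.
End position_verlet.

(** * The CFL constant and the two energy statements *)

Lemma energy_modified_norm2 (R : realType) (d p : nat) (G : seq ('rV[R]_d * R)) (T : mesh R d)
    (S : 'End(dgspace p T)) Y :
  energy G S Y = modified_norm2 G \1%VF S Y.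
Proof. by rewrite /modified_norm2 id_lfunE. Qed.

(** The CFL condition bounds [tau / h] by [Ccfl], and [Ccfl * Num.sqrt Cs < 2] puts the resulting
    factor below 1. *)
Lemma cfl_bound (R : rcfType) (Cs Ccfl h tau c : R) :
  0 < Cs -> 0 <= h -> Ccfl < 2 / Num.sqrt Cs -> 0 < tau -> tau < Ccfl * h -> 0 <= c ->
  tau ^+ 2 / 4 * (Cs * h ^- 2 * c) <= Cs * Ccfl ^+ 2 / 4 * c /\ Cs * Ccfl ^+ 2 / 4 < 1.
Proof.
move=> Cs0 h0 CcflC tau0 tauC c0.
(* At [h = 0] the CFL condition would contradict [0 < tau]. *)
have h_gt0 : 0 < h.
  rewrite lt_def h0 andbT; apply: contraTneq tauC => ->.
  by rewrite mulr0 -leNgt ltW.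
have C0 : 0 < Ccfl by rewrite -(pmulr_lgt0 _ h_gt0) (lt_trans tau0).
have sC0 : 0 < Num.sqrt Cs by rewrite sqrtr_gt0.
split; last first.
  rewrite ltr_pdivrMr// mul1r -[Cs]sqr_sqrtr ?ltW// -exprMn.
  have : Num.sqrt Cs * Ccfl < 2 by rewrite mulrC -ltr_pdivlMr.
  have : 0 < Num.sqrt Cs * Ccfl by exact: mulr_gt0.
  nra.
rewrite mulrA ler_wpM2r//.
have : (tau / h) ^+ 2 <= Ccfl ^+ 2.
  by rewrite lerXn2r ?nnegrE ?divr_ge0 ?ltW// ltr_pdivrMr.
rewrite expr_div_n => th.
have -> : tau ^+ 2 / 4 * (Cs * h ^- 2) = Cs / 4 * (tau ^+ 2 / h ^+ 2) by field; rewrite gt_eqF.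
have -> : Cs * Ccfl ^+ 2 / 4 = Cs / 4 * Ccfl ^+ 2 by field.
by rewrite ler_wpM2l// divr_ge0// ltW.
Qed.

Theorem theorem5p3 (R : realType) (d p : nat)
    (d_le3 : (1 <= d <= 3)%N) (p_ge1 : (1 <= p)%N)
    (G : seq ('rV[R]_d * R)) (domG : polytopal_domain G)
    (Dm : 'rV[R]_d -> 'M[R]_d) (dmin dmax : R)
    (diffDm : diffusion_coefficient G Dm dmin dmax)
    (meshes : set (mesh R d)) (rqu : regular_quasi_uniform G meshes)
    (sigma0 : R) (sigma0_gt0 : 0 < sigma0)
    (coercive : forall T, meshes T -> forall u : dgspace p T,
       2^-1 * star_norm2 u <= sip_form Dm sigma0 u u)
    (Cs : R) (Cs_gt0 : 0 < Cs)
    (inverse_ineq : forall T, meshes T -> forall u : dgspace p T,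
       sip_form Dm sigma0 u u <= Cs * mesh_size T ^- 2 * dgnorm G u ^+ 2)
    (Ccfl : R) (Ccfl_lt : Ccfl < 2 / Num.sqrt Cs) :
  exists C : R,
  forall (dd : measure_display) (Omega : measurableType dd)
    (P : probability Omega R) (Fil : R -> set (set Omega)),
  normal_filtration P Fil ->
  forall Q Qhalf : L2 G -> L2 G, psd_operator Q -> sqrt_operator Q Qhalf ->
  forall W : R -> Omega -> L2 G, wiener_process P Fil Q W ->
  forall e : nat -> L2 G, orthonormal_basis e ->
  (HS2 e Qhalf < +oo)%E ->
  forall T, meshes T ->
  forall Lam Lamhalf : 'End(dgspace p T),
  discrete_operator G Dm sigma0 Lam -> dg_sqrt G Lam Lamhalf ->
  forall Ph : L2 G -> dgspace p T, l2_projection Ph ->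
  forall tau : R, 0 < tau -> tau < Ccfl * mesh_size T ->
  forall Minvhalf : 'End(dgspace p T),
  dg_sqrt G ((\1 - (tau ^+ 2 / 4) *: Lam)^-1)%VF Minvhalf ->
  forall Y0 : Omega -> dgspace p T * dgspace p T,
  dg_random_variable (Fil 0) Y0 ->
  (('E_P[fun w => H1_norm2 G Lamhalf (Y0 w)]) `^ 2^-1 < +oo)%E ->
  forall n : nat,
  let Y := position_verlet tau Lam Ph W Y0 in
  let tn : R := n%:R * tau in
  'E_P[fun w => modified_norm2 G Minvhalf Lamhalf (Y n w)]%E =
    ('E_P[fun w => modified_norm2 G Minvhalf Lamhalf (Y0 w)] +
     tn%:E * \sum_(k <oo)
       (modified_norm2 G Minvhalf Lamhalf (verlet_D tau (Ph (Qhalf (e k)))))%:E)%E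
  /\
  ('E_P[fun w => energy G Lamhalf (Y n w)] <=
     C%:E * ('E_P[fun w => H1_norm2 G Lamhalf (Y0 w)] + tn%:E * HS2 e Qhalf))%E.
Proof.
have meshG := rqu.1.
(* The constant depends on [Cs] and [Ccfl] alone and is fixed before the mesh, [tau] and [n]. *)
exists (1 - Cs * Ccfl ^+ 2 / 4)^-1; set theta := Cs * Ccfl ^+ 2 / 4.
move=> dd Omega P F nF Q Qhalf psdQ sqQ W wW e onb _ T mT Lam S LamP [S_sym S_ge0 SS].
move=> Ph PhP tau tau0 tauC M [M_sym M_ge0 MM] Y0 mY0 _ n Y tn.
have meshT := meshG _ mT.
pose b (u v : dgspace p T) := dgdot G u v.
have pb : psd_form b := dgdot_psd_form domG meshT.
have h0 : 0 <= mesh_size T by exact: bigmax_ge_id.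
have cfl_u u := cfl_bound Cs_gt0 h0 Ccfl_lt tau0 tauC (form_ge0 pb u).
have theta1 : theta < 1 by have [] := cfl_u 0.
have cfl u : tau ^+ 2 / 4 * b (Lam u) u <= theta * b u u.
  apply: le_trans (cfl_u u).1; rewrite ler_wpM2l ?divr_ge0 ?sqr_ge0//.
  by rewrite /b LamP -(dgnorm_sqr domG meshT); exact: inverse_ineq.
have Lam_sym u v : b (Lam u) v = b u (Lam v).
  by rewrite -SS !comp_lfunE /b !S_sym.
have modE v : modified_norm2 G M S v = verlet_form b S M v v.
  by rewrite /modified_norm2 !(dgnorm_sqr domG meshT).
set C := (1 - theta)^-1.
have C_ge1 : 1 <= C.
  rewrite -[leLHS]invr1 lef_pV2 ?posrE ?subr_gt0// lerBlDr lerDl.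
  by rewrite divr_ge0// mulr_ge0 ?sqr_ge0// ltW.
have C_ge0 : 0 <= C by exact: le_trans C_ge1.
have [s sE] := modified_norm2_sum_squares domG meshT S_sym M_sym.
have id_sym (u v : dgspace p T) : dgdot G (\1%VF u) v = dgdot G u (\1%VF v).
  by rewrite !id_lfunE.
(* With the identity for [M], this decomposition yields the measurability of the discrete energy. *)
have [s' s'E] := modified_norm2_sum_squares domG meshT S_sym id_sym.
have inv v : \sum_(phi <- s) 2^-1 * pairing G (verlet_M tau Lam v) phi ^+ 2 =
    \sum_(phi <- s) 2^-1 * pairing G v phi ^+ 2.
  by rewrite -!sE !modE; exact: (verlet_form_invariant pb S_sym SS M_sym MM theta1 cfl).
(* Expand into squares, exchange the two nonnegative sums, and apply Parseval to each functional. *)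
have noise : (\sum_(k <oo) (modified_norm2 G M S (verlet_D tau (Ph (Qhalf (e k)))))%:E =
    (\sum_(phi <- s) 2^-1 * l2dot G (Q (dgL2 domG meshT ((tau / 2) *: phi.1 + phi.2)))
       (dgL2 domG meshT ((tau / 2) *: phi.1 + phi.2)))%:E)%E.
  under eq_eseriesr => k _ do rewrite sE -sumEFin.
  rewrite nneseries_sum => [|phi k _]; last by rewrite lee_fin mulr_ge0// sqr_ge0.
  rewrite -sumEFin; apply: eq_bigr => phi _.
  under eq_eseriesr => k _ do rewrite (pairing_verlet_D domG meshT _ PhP) EFinM.
  rewrite nneseriesZl => [|k _]; last by rewrite lee_fin sqr_ge0.
  by rewrite (parseval_sqrt onb _ sqQ).
have expE : ('E_P[fun w => modified_norm2 G M S (Y n w)] =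
    'E_P[fun w => modified_norm2 G M S (Y0 w)] +
    tn%:E * \sum_(k <oo) (modified_norm2 G M S (verlet_D tau (Ph (Qhalf (e k)))))%:E)%E.
  rewrite noise -EFinM; under eq_fun do rewrite sE.
  under [in X in (X + _)%E]eq_fun do rewrite sE.
  exact: (expectation_position_verlet domG meshT nF psdQ wW PhP tau0 Lam_sym mY0 n inv).
split => //.
have mY k phi : measurable_fun setT (fun w => pairing G (Y k w) phi).
  exact: (measurable_position_verlet domG meshT nF wW PhP tau0 Lam_sym mY0 k phi).
have msum k (r : seq (dgspace p T * dgspace p T)) :
    measurable_fun setT (fun w => \sum_(phi <- r) 2^-1 * pairing G (Y k w) phi ^+ 2).
  by apply: measurable_sum => phi; apply: measurable_funM => //; exact: measurable_funX.
have mmod k : measurable_fun setT (fun w => modified_norm2 G M S (Y k w)).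
  by under eq_fun do rewrite sE; exact: msum.
have menergy k : measurable_fun setT (fun w => energy G S (Y k w)).
  by under eq_fun do rewrite energy_modified_norm2 s'E; exact: msum.
have sq_ge0 (v : dgspace p T) : 0 <= dgnorm G v ^+ 2 by rewrite sqr_ge0.
have energyE v : energy G S v = 2^-1 * b (S v.1) (S v.1) + 2^-1 * b v.2 v.2.
  by rewrite /energy !(dgnorm_sqr domG meshT).
have energy_ge0 v : 0 <= energy G S v by rewrite /energy addr_ge0// mulr_ge0.
have energy_le v : energy G S v <= modified_norm2 G M S v.
  by rewrite modE energyE; exact: (energy_le_verlet_form pb S_sym SS M_sym MM theta1 cfl).
have mod_le v : modified_norm2 G M S v <=
    2^-1 * (C * b (S v.1) (S v.1)) + 2^-1 * b v.2 v.2.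
  by rewrite modE; exact: (verlet_form_le pb S_sym SS M_sym MM theta1 cfl).
have mod_ge0 v : 0 <= modified_norm2 G M S v by exact: le_trans (energy_le v).
have mod_le_H1 v : modified_norm2 G M S v <= C * H1_norm2 G S v.
  apply: (le_trans (mod_le v)); rewrite /H1_norm2 !(dgnorm_sqr domG meshT) -/(b _ _) -/(b v.2 _).
  have := form_ge0 pb (S v.1); have := form_ge0 pb v.2.
  move: (b (S v.1) _) (b v.2 _) => x y y0 x0; rewrite mulrDr lerD//.
    by rewrite ler_piMl ?mulr_ge0// invf_le1// ler1n.
  by rewrite ler_wpM2r// (le_trans _ C_ge1)// invf_le1// ler1n.
(* The projection is a contraction: the squared norm of [f - Ph f] is nonnegative and equals the
   difference of the two sides. *)
have Ph_le f : b (Ph f) (Ph f) <= l2norm G f ^+ 2.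
  rewrite l2norm_sqr; have pL := l2dot_psd_form G.
  have := form_ge0 pL (f - dgL2 domG meshT (Ph f)).
  have fPh : l2dot G f (dgL2 domG meshT (Ph f)) = b (Ph f) (Ph f) by rewrite /b PhP.
  rewrite !(formE pL) (formC pL (dgL2 _ _ _) f) fPh.
  rewrite -[l2dot G (dgL2 _ _ _) (dgL2 _ _ _)]/(b _ _); lra.
(* The position part contributes [tau^2/4 (Lam Ph f, Ph f)], at most the squared norm of [Ph f] by
   the CFL bound; both halves are then at most [C / 2] times the squared norm of [f]. *)
have mod_noise f : modified_norm2 G M S (verlet_D tau (Ph f)) <= C * l2norm G f ^+ 2.
  apply: le_trans (mod_le _) _; rewrite /= endZ !(formE pb).
  set x := b (S _) _; have xE : x = b (Lam (Ph f)) (Ph f).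
    by rewrite -SS comp_lfunE /x /b [RHS]S_sym.
  have : tau ^+ 2 / 4 * x <= b (Ph f) (Ph f).
    rewrite xE (le_trans (cfl _))// ler_piMl ?(form_ge0 pb)//; exact: ltW.
  have := Ph_le f; have := form_ge0 pb (Ph f); move: (b _ _) (l2norm _ _ ^+ 2) => y z y0 yz xy.
  have : 2^-1 * (C * (tau ^+ 2 / 4 * x)) <= 2^-1 * (C * z).
    by rewrite ler_wpM2l// ler_wpM2l// (le_trans xy).
  have : 2^-1 * y <= 2^-1 * (C * z).
    by rewrite ler_wpM2l// (le_trans yz)// ler_peMl// (le_trans y0).
  have -> : tau / 2 * (tau / 2 * x) = tau ^+ 2 / 4 * x by field.
  lra.
(* The discrete energy is dominated pointwise by the modified one, whose expectation is known
   exactly; its initial and noise terms are then bounded separately. *)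
apply: (@le_trans _ _ 'E_P[fun w => modified_norm2 G M S (Y n w)]%E).
  rewrite unlock; apply: ge0_le_integral => //.
  - by move=> w _; rewrite lee_fin.
  - exact/measurable_EFinP.
  - exact/measurable_EFinP.
  - by move=> w _; rewrite lee_fin.
rewrite expE ge0_muleDr; last 2 first.
- by rewrite unlock integral_ge0// => w _; rewrite lee_fin addr_ge0.
- rewrite mule_ge0// ?lee_fin ?mulr_ge0 ?(ltW tau0)//; apply: nneseries_ge0 => k _ _.
  by rewrite lee_fin sqr_ge0.
apply: leeD.
  have mH1 : measurable_fun setT (fun w => H1_norm2 G S (Y0 w)).
    (* The squared norm is twice the initial discrete energy, already known to be measurable. *)
    have -> : (fun w => H1_norm2 G S (Y0 w)) = (fun w => 2 * energy G S (Y 0 w)).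
      by apply/funext => w; rewrite /energy -mulrDr mulrA divff// mul1r.
    exact: measurable_funM.
  rewrite unlock -ge0_integralZl//.
  - apply: ge0_le_integral => //.
    + by move=> w _; rewrite lee_fin.
    + by apply/measurable_EFinP; exact: (mmod 0).
    + by apply/measurable_EFinP; exact: measurable_funM.
    + by move=> w _; rewrite -EFinM lee_fin.
  - exact/measurable_EFinP.
  - by move=> w _; rewrite lee_fin addr_ge0.
rewrite muleCA; apply: lee_wpmul2l; first by rewrite lee_fin mulr_ge0// ltW.
rewrite /HS2 -nneseriesZl => [|k _]; last by rewrite lee_fin sqr_ge0.
by apply: lee_nneseries => k _; rewrite -?EFinM lee_fin.
Qed.
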